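(* There is a randomized implementation of a (linearizable) TAS object for $n$ processes from $\Theta(n)$ registers whose expected max-step complexity against any location-oblivious adversary is $O(\log^\ast k)$, where $k$ is the max-contention of the $\mathrm{TAS}()$ operation.
   Context: Model. There are $n$ processes with IDs $1,\dots,n$ in an asynchronous shared-memory system communicating via atomic multi-reader multi-writer read/write registers. Algorithms are randomized: a coin flip is a private local step returning a value drawn from a fixed distribution on a countable set; w.l.o.g. each process alternates coin-flip steps and shared-memory steps. An adversary is a function mapping each finite execution to the ID of the process taking the next step; algorithm $M$, adversary $A$ and a random coin-flip vector yield a random execution $\mathcal E_{M,A}$. A location-oblivious adversary chooses the next process based only on (i) the past schedule, (ii) the outcomes of each process $p$'s coin flips that precede $p$'s latest shared-memory step, and (iii) for each unfinished process whose next step is a shared-memory step, whether it is a read or a write and the value to be written; it does not know which register a process will access next if that register is chosen by a coin flip taken after the process's latest shared-memory step. A TAS object stores a bit, initially $0$, and supports a one-time operation $\mathrm{TAS}()$ (each process calls it at most once) that sets the bit and returns its previous value; the implementation must be linearizable. Complexity. For an execution $\mathcal E$ of an algorithm $M$ using the object, let $T_p(\mathcal E)$ be the number of shared-memory steps $p$ takes in its $\mathrm{TAS}()$ call; let $\mathcal E'$ be the prefix ending when the first process becomes poised to invoke $\mathrm{TAS}()$; the max-contention $k$ is the maximum number of processes invoking $\mathrm{TAS}()$ in any execution of $M$ extending $\mathcal E'$. The expected max-step complexity against an adversary model is $\tau(k)=\sup\mathbb E[\max_p T_p(\mathcal E_{M,A})\mid \mathcal E_{M,A}\text{ extends }\mathcal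 E']$, over all algorithms $M$, adversaries $A$ in the model, and prefixes $\mathcal E'$ arising under $A$ with max-contention at most $k$. $\log^\ast k=\inf\{i: \log_2^{(i)}k\le 1\}$. *)

(* Defs.v *)
From HB Require Import structures.
From mathcomp Require Import all_boot all_order all_algebra.
From mathcomp Require Import all_classical all_reals all_analysis.
From mathcomp Require Import Rstruct.
Set Implicit Arguments.
Unset Strict Implicit.
Unset Printing Implicit Defensive.
Import Order.TTheory GRing.Theory Num.Theory.
Local Open Scope ring_scope.

Definition Rl : realType := Rdefinitions.R.

Record dist := Dist {
  dm :> nat -> Rl;
  dm_ge0 : forall k, 0 <= dm k;
  dm_sum : (\sum_(0 <= k <oo) (dm k)%:E = 1)%E }.

(* Shared-memory operations on registers with locations of type L;
   registers hold natural numbers (any countable value set). *)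
Inductive op (L : Type) := ORead of L | OWrite of L & nat.

(* Alternation of coin-flip steps and shared-memory steps is built in:
   a "step" action [MStep d f] means: first a coin-flip step drawing k from d,
   then (as a separate, later-scheduled step) the shared-memory step [f k]. *)

(* Actions of the algorithm M using the TAS object (its own registers: nat). *)
Inductive mact := MStep of dist & (nat -> op nat) | MInvoke | MDone.
Inductive iact (m : nat) := IStep of dist & (nat -> op 'I_m) | IReturn of bool.

(* An algorithm for processes 'I_n: each process's next action is a function
   of its local history (coin outcomes, values read, TAS responses). *)
Definition malg (n : nat) := 'I_n -> seq nat -> mact.

Record impl (n m : nat) := Impl {
  iinit : 'I_m -> nat;
  iprog : 'I_n -> seq nat -> iact m }.

(* executions: the schedule together with the coin outcomes
   (the outcome component is 0 for non-coin-flip steps) *)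
Definition exec (n : nat) := seq ('I_n * nat)%type.

Inductive event (n : nat) := Inv of 'I_n | Resp of 'I_n & bool.
Inductive kind := KFlip | KShmM | KShmI | KLocal.
Inductive pend := PNone | PRead | PWrite of nat.

Definition is_flip (x : kind) := if x is KFlip then true else false.
Definition is_shmI (x : kind) := if x is KShmI then true else false.
Definition is_shm (x : kind) :=
  match x with KShmM | KShmI => true | _ => false end.

(* Linearizability of a history of a one-shot TAS object (bit initially 0,
   TAS sets it and returns the previous value; false = 0, true = 1):
   there is a sequential order L of all completed and some pending operations,
   respecting real-time order, that is legal for the sequential specification. *)
Definition linearizable (n : nat) (h : seq (event n)) : Prop :=
  exists L : seq 'I_n, [/\ uniq L,
    (forall p, p \in L -> List.In (Inv p) h),
    (forall p b, List.In (Resp p b) h -> p \in L),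
    (forall p q b i j, List.nth_error h i = Some (Resp p b) ->
        List.nth_error h j = Some (Inv q) -> (i < j)%N -> q \in L ->
        (index p L < index q L)%N) &
    (forall p b, List.In (Resp p b) h -> b = (index p L != 0%N))].

Definition adversary (n : nat) := exec n -> 'I_n.

Section Semantics.
Variables (n m : nat) (I : impl n m) (M : malg n).

Record lstate := LS {
  mh : seq nat;
  invd : bool;
  ih : option (seq nat);   (* Some h while inside the TAS() call *)
  pf : option nat }.       (* outcome of a coin flip whose shm step is pending *)

Record config := Cfg {
  loc : 'I_n -> lstate;
  mmem : nat -> nat;
  imem : 'I_m -> nat }.

Definition init_cfg : config :=
  Cfg (fun _ => LS [::] false None None) (fun _ => 0%N) (iinit I).

Inductive nact :=
  NFlip of dist | NShmM of op nat | NShmI of op 'I_m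
| NInvoke | NReturn of bool | NDone.

(* next step of process p; NDone = finished (TAS is invoked at most once:
   a second invocation attempt makes the process stop). *)
Definition next (c : config) (p : 'I_n) : nact :=
  let s := loc c p in
  match ih s with
  | Some h => match iprog I p h with
              | IReturn b => NReturn b
              | IStep d f => if pf s is Some k then NShmI (f k) else NFlip d
              end
  | None => match M p (mh s) with
            | MStep d f => if pf s is Some k then NShmM (f k) else NFlip d
            | MInvoke => if invd s then NDone else NInvoke
            | MDone => NDone
            end
  end.

Definition kind_of (a : nact) : kind :=
  match a with NFlip _ => KFlip | NShmM _ => KShmM | NShmI _ => KShmI
  | _ => KLocal end.

Definition upd_loc (c : config) (p : 'I_n) (s : lstate) : config :=
  Cfg (fun q => if q == p then s else loc c q) (mmem c) (imem c).

Definition step (c : config) (p : 'I_n) (k : nat) : config * option (event n) :=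
  let s := loc c p in
  let fk := odflt 0%N (pf s) in
  match next c p with
  | NFlip _ => (upd_loc c p (LS (mh s) (invd s) (ih s) (Some k)), None)
  | NShmM (ORead r) =>
      (upd_loc c p (LS (mh s ++ [:: fk; mmem c r]) (invd s) (ih s) None), None)
  | NShmM (OWrite r v) =>
      let c' := Cfg (loc c) (fun r' => if r' == r then v else mmem c r') (imem c) in
      (upd_loc c' p (LS (mh s ++ [:: fk; 0%N]) (invd s) (ih s) None), None)
  | NShmI (ORead r) =>
      (upd_loc c p (LS (mh s) (invd s)
         (Some (odflt [::] (ih s) ++ [:: fk; imem c r])) None), None)
  | NShmI (OWrite r v) =>
      let c' := Cfg (loc c) (mmem c) (fun r' => if r' == r then v else imem c r') in
      (upd_loc c' p (LS (mh s) (invd s)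
         (Some (odflt [::] (ih s) ++ [:: fk; 0%N])) None), None)
  | NInvoke => (upd_loc c p (LS (mh s) true (Some [::]) None), Some (Inv p))
  | NReturn b =>
      (upd_loc c p (LS (rcons (mh s) (nat_of_bool b)) (invd s) None None),
       Some (Resp p b))
  | NDone => (c, None)
  end.

Fixpoint run_from (c : config) (e : exec n)
  : config * seq ('I_n * nat * kind * option (event n)) :=
  match e with
  | [::] => (c, [::])
  | (p, k) :: e' =>
      let r := run_from (step c p k).1 e' in
      (r.1, (p, k, kind_of (next c p), (step c p k).2) :: r.2)
  end.

Definition cfg (e : exec n) := (run_from init_cfg e).1.
Definition elog (e : exec n) := (run_from init_cfg e).2.

Fixpoint valid_from (c : config) (e : exec n) : bool :=
  match e with
  | [::] => true
  | (p, k) :: e' =>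
      (match next c p with NFlip d => 0 < d k | _ => k == 0%N end)
      && valid_from (step c p k).1 e'
  end.
Definition valid (e : exec n) := valid_from init_cfg e.

Definition hist (e : exec n) : seq (event n) := pmap (fun x => x.2) (elog e).

Definition Tsteps (e : exec n) (p : 'I_n) : nat :=
  count (fun x => (x.1.1.1 == p) && is_shmI x.1.2) (elog e).
Definition maxT (e : exec n) : nat := \max_(p < n) Tsteps e p.

Definition vis_coins (e : exec n) (p : 'I_n) : seq nat :=
  let lg := elog e in
  let i := (size lg - (find (fun x => (x.1.1.1 == p) && is_shm x.1.2)
                            (rev lg)).+1)%N in
  [seq x.1.1.2 | x <- take i lg & (x.1.1.1 == p) && is_flip x.1.2].

Definition pending (e : exec n) (p : 'I_n) : pend :=
  match next (cfg e) p with
  | NShmM (ORead _) | NShmI (ORead _) => PRead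
  | NShmM (OWrite _ v) | NShmI (OWrite _ v) => PWrite v
  | _ => PNone
  end.

Definition oblivious (A : adversary n) : Prop :=
  forall e1 e2 : exec n, valid e1 -> valid e2 ->
    map fst e1 = map fst e2 ->
    (forall p, vis_coins e1 p = vis_coins e2 p) ->
    (forall p, pending e1 p = pending e2 p) ->
    A e1 = A e2.

Definition follows (A : adversary n) (e : exec n) : Prop :=
  forall i p k, List.nth_error e i = Some (p, k) -> p = A (take i e).

Definition first_poised (e : exec n) : Prop :=
  (exists p, next (cfg e) p = NInvoke) /\
  (forall i, (i < size e)%N -> forall p, next (cfg (take i e)) p <> NInvoke).

Definition contention_le (e : exec n) (k : nat) : Prop :=
  forall s : exec n, valid (e ++ s) ->
    (#|[pred p | invd (loc (cfg (e ++ s)) p)]| <= k)%N.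

(* E[max_p T_p | execution extends e] under adversary A, computed on the
   probability tree of depth N and then taking the supremum over N
   (monotone convergence). *)
Fixpoint expN (A : adversary n) (N : nat) (e : exec n) : \bar Rl :=
  match N with
  | 0 => ((maxT e)%:R)%:E
  | N'.+1 =>
      let p := A e in
      match next (cfg e) p with
      | NFlip d => (\sum_(0 <= k <oo) ((d k)%:E * expN A N' (rcons e (p, k))))%E
      | _ => expN A N' (rcons e (p, 0%N))
      end
  end.

Definition expT (A : adversary n) (e : exec n) : \bar Rl :=
  ereal_sup (range (fun N => expN A N e)).

End Semantics.

Definition log2 (x : Rl) : Rl := ln x / ln 2.
Fixpoint iterlog (i : nat) (x : Rl) : Rl :=
  if i is i'.+1 then log2 (iterlog i' x) else x.
(* least i with log2^(i) k <= 1 (such an i <= k always exists) *)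
Definition logstar (k : nat) : nat :=
  find (fun i => iterlog i k%:R <= 1) (iota 0 k.+1).

(* Main.v *)
(* The algorithm follows Giakkoupis and Woelfel.  A process that finds the door
   open climbs through levels.  At a level [i < width] it first takes part in a
   group election: it marks a location [x] drawn from a truncated geometric
   distribution and survives if location [x+1] is unmarked.  Then it passes a
   splitter (write your name; lose if the gate is closed; close the gate; stop
   if the name is still yours, else climb to the next level).  At most one
   process stops per level, and it walks back down to level 0, racing at each
   level against the winner of the level above.  A loser shuts the door before
   it returns.

   Safety.  A nonzero register, names and the dummy aside, is a mark with a rank.  A process loses only
   after it has read a mark of rank larger than its own, and some process that
   has not lost always has at least that rank; so not everybody loses.

   Complexity.  The location of a pending write is hidden from the adversary, so
   coins may be resolved at the write instead of at the flip.  With deferred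
   coins a potential of the visible state is a supermartingale.  Before somebody
   marks location [x+1], an expected number of at most 2 processes mark [x];
   hence [m] processes have about [2 log m] survivors, and after log* k + O(1)
   levels only O(1) are expected.  From then on each level retains at least one
   process.  A race has constant expected length because a contestant advances
   with probability 1/2, invisibly. *)

Require Import Defs.
From HB Require Import structures.
From mathcomp Require Import all_boot all_order all_algebra.
From mathcomp Require Import all_classical all_reals all_analysis.
From mathcomp Require Import Rstruct.
From mathcomp Require Import zify ring lra.
Set Implicit Arguments.
Unset Strict Implicit.
Unset Printing Implicit Defensive.
Set Bullet Behavior "Strict Subproofs".
Import Order.TTheory GRing.Theory Num.Theory.

(** * The automaton *)

(** What has to be bounded is the expectation of the maximum of all step counts, not that of one
    fixed process. So one potential must dominate all counts at once. Steps outside the races are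
    proportional to the level reached, and beyond any level [i0] no process can be further up than
    the number of processes that entered [i0], because each splitter holds one back. Steps in races
    are summed over all processes.

    Probability is kept away from the model: the automaton has no flip steps, takes its coin
    together with the shared-memory step, and is safe for every value of it. The bridge averages
    over independent hidden coins along executions that the adversary cannot distinguish. Only the
    coins of the TAS call are deferred; those of the calling algorithm are averaged when flipped,
    since the potential does not see them.

    Group elections exist only on about log n levels with about log n locations each, hence O(log^2
    n) registers, and every level adds four registers for splitter and race: linear in total. The
    level [i0] belongs to the analysis; the program does not know [k]. *)

Inductive reg :=
  RDoor | RDummy | RGrp of nat & nat | RX of nat | RY of nat | RRace of nat & bool.

Definition reg_eqb (r s : reg) : bool :=
  match r, s with
  | RDoor, RDoor | RDummy, RDummy => true
  | RGrp i x, RGrp j y => (i == j) && (x == y)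
  | RX i, RX j | RY i, RY j => i == j
  | RRace i a, RRace j b => (i == j) && (a == b)
  | _, _ => false
  end.

Lemma reg_eqbP : Equality.axiom reg_eqb.
Proof.
case=> [||i x|i|i|i a] [||j y|j|j|j b] /=;
  try (by constructor); try (by apply: (iffP eqP) => [->|[]]);
  by apply: (iffP andP) => [[/eqP-> /eqP->]|[-> ->]].
Qed.
HB.instance Definition _ := hasDecEq.Build reg reg_eqbP.

Lemma regE (r s : reg) : (r == s) = reg_eqb r s. Proof. by []. Qed.

Inductive phase :=
  PDoor | PGrpW | PGrpR | PXW | PYR | PYW | PXR | PRaceW | PRaceR | PLose | PRet of bool.

(* A process at level [i] has [tp = i.+1] ([tp = 0] before it passes the door).
   After it has stopped in the splitter of its level, [le = j.+1] says that it
   takes part in the race of level [j], and [le = 0] that it has won all its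
   races. [rr] is the value of its register in the current race, [lc] the number
   of steps it has taken in races, [cn] the number of all its steps. *)
Record lst := Lst {
  ph : phase; tp : nat; le : nat; gx : nat; rr : nat; stp : bool;
  lc : nat; cn : nat }.

Definition lst0 := Lst PDoor 0 0 0 0 false 0 0.

Variant act := ARead of reg | AWrite of reg & nat.

(* The process that stopped in the splitter of the level of the race has role
   [false] there, the winner of the race of the next level has role [true]. *)
Definition role (l : lst) : bool := le l != tp l.

Definition active (l : lst) : bool := if ph l is PRet _ then false else true.

Definition nonlost (l : lst) : bool :=
  (0 < tp l) && match ph l with PLose | PRet true => false | _ => true end.

Section Automaton.
Variables (n B : nat).

(** Only the first [B] levels hold a group election. Later ones are bare splitters, which still hold
    back one process each, so [n] levels suffice. *)
Definition enter (i : nat) : phase := if i < B then PGrpW else PXW.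

(* The adversary sees the value of a pending write but not its register: it
   cannot tell a write to [RDummy] from one that advances in the race. *)
Definition action (p : 'I_n) (l : lst) (x : nat) : act :=
  match ph l with
  | PDoor => ARead RDoor
  | PGrpW => AWrite (RGrp (tp l).-1 x) 1
  | PGrpR => ARead (RGrp (tp l).-1 (gx l).+1)
  | PXW => AWrite (RX (tp l).-1) p.+1
  | PYR => ARead (RY (tp l).-1)
  | PYW => AWrite (RY (tp l).-1) 1
  | PXR => ARead (RX (tp l).-1)
  | PRaceW =>
      AWrite (if x == 0 then RRace (le l).-1 (role l) else RDummy) (rr l).+1
  | PRaceR => ARead (RRace (le l).-1 (~~ role l))
  | PLose => AWrite RDoor 1
  | PRet _ => ARead RDummy
  end.

Definition delta (p : 'I_n) (l : lst) (x v : nat) : lst :=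
  let: Lst f t e g r s c k := l in
  match f with
  | PDoor => if v != 0 then Lst (PRet true) t e g r s c k.+1
             else Lst (enter 0) 1 e g r s c k.+1
  | PGrpW => Lst PGrpR t e x r s c k.+1
  | PGrpR => Lst (if v != 0 then PLose else PXW) t e g r s c k.+1
  | PXW => Lst PYR t e g r s c k.+1
  | PYR => Lst (if v != 0 then PLose else PYW) t e g r s c k.+1
  | PYW => Lst PXR t e g r s c k.+1
  | PXR => if v == p.+1 then Lst PRaceW t t g 0 true c k.+1
           else Lst (enter t) t.+1 e g r s c k.+1
  | PRaceW => Lst PRaceR t e g (if x == 0 then r.+1 else r) s c.+1 k.+1
  | PRaceR =>
      if r < v then Lst PLose t e g r s c.+1 k.+1
      else if v.+2 <= r then
        Lst (if e.-1 == 0 then PRet false else PRaceW) t e.-1 g 0 s c.+1 k.+1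
      else Lst PRaceW t e g r s c.+1 k.+1
  | PLose => Lst (PRet true) t e g r s c k.+1
  | PRet _ => l
  end.

Record st := St { lo : 'I_n -> option lst; me : reg -> nat }.

Definition st0 := St (fun _ => None) (fun _ => 0).

Definition setl (s : st) (p : 'I_n) (l : lst) (m : reg -> nat) :=
  St (fun q => if q == p then Some l else lo s q) m.

Definition ainv (p : 'I_n) (s : st) : st := setl s p lst0 (me s).

Definition memw (m : reg -> nat) (a : act) : reg -> nat :=
  if a is AWrite r v then (fun r' => if r' == r then v else m r') else m.
Definition memr (m : reg -> nat) (a : act) : nat := if a is ARead r then m r else 0.

Definition astep (p : 'I_n) (x : nat) (s : st) : st :=
  if lo s p is Some l then
    let a := action p l x in
    setl s p (delta p l x (memr (me s) a)) (memw (me s) a)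
  else s.

Inductive reach : st -> Prop :=
| reach0 : reach st0
| reachI s p : reach s -> lo s p = None -> reach (ainv p s)
| reachS s p l x : reach s -> lo s p = Some l -> active l -> x < B ->
    reach (astep p x s).

Lemma astepE s p l x : lo s p = Some l ->
  astep p x s = setl s p (delta p l x (memr (me s) (action p l x)))
                         (memw (me s) (action p l x)).
Proof. by rewrite /astep => ->. Qed.

Lemma lo_setl s p l m q :
  lo (setl s p l m) q = if q == p then Some l else lo s q.
Proof. by []. Qed.

Lemma lo_setlP s p l m q lq : lo (setl s p l m) q = Some lq ->
  (q = p /\ lq = l) \/ (q <> p /\ lo s q = Some lq).
Proof.
rewrite lo_setl; case: eqP => [-> [<-]|ne h]; [by left|by right].
Qed.

Lemma lo_setl_eq s p l m : lo (setl s p l m) p = Some l.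
Proof. by rewrite lo_setl eqxx. Qed.

Lemma lo_setl_neq s p l m q : q <> p -> lo (setl s p l m) q = lo s q.
Proof. by rewrite lo_setl; case: eqP. Qed.

End Automaton.

Ltac enter_tac :=
  repeat match goal with H : context [enter ?b ?i] |- _ =>
    move: H; rewrite /enter; case: ifP => ? ? end;
  rewrite /enter; try case: ifP => ?.

(** * Safety *)

Section Safety.
Variables (n B : nat).
Implicit Types (s : st n) (p q : 'I_n) (l : lst).

Lemma reach_local (P : 'I_n -> lst -> Prop) s : (forall p, P p lst0) ->
  (forall p l x v, P p l -> active l -> x < B -> P p (delta B p l x v)) ->
  reach B s -> forall p l, lo s p = Some l -> P p l.
Proof.
move=> P0 PS; elim=> {s} [//|s p rs IH h|s p l x rs IH h al xB] q lq.
  by case/lo_setlP=> [[-> ->]|[_ /IH]].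
rewrite (astepE B x h) => /lo_setlP[[-> ->]|[_ /IH //]].
by apply: PS => //; apply: IH.
Qed.

Definition wf l : bool :=
  match ph l with
  | PDoor => (tp l == 0) && ~~ stp l
  | PGrpW => [&& 0 < tp l, tp l <= B & ~~ stp l]
  | PGrpR => [&& 0 < tp l, tp l <= B, gx l < B & ~~ stp l]
  | PXW | PYR | PYW | PXR => (0 < tp l) && ~~ stp l
  | PRaceW | PRaceR => [&& stp l, 0 < le l & le l <= tp l]
  | PLose => (0 < tp l) && (stp l ==> (0 < le l <= tp l))
  | PRet true => stp l ==> (0 < le l <= tp l)
  | PRet false => [&& stp l, 0 < tp l & le l == 0]
  end.

Lemma reach_wf s : reach B s -> forall p l, lo s p = Some l -> wf l.
Proof.
apply: reach_local => // p [f t e g r st c k] x v; rewrite /wf /delta /=.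
case: f => [||||||||||b] //=; rewrite /enter /active /=;
  repeat case: ifP => //=; try lia; by case: b.
Qed.

(** A level takes at most six steps outside the races. The surplus 2 in the returned state is the
    read of the door and the final write that shuts it. *)
Definition cost l : bool :=
  match ph l with
  | PDoor => cn l == 0
  | PGrpW => cn l + 5 <= 6 * tp l + lc l
  | PGrpR => cn l + 4 <= 6 * tp l + lc l
  | PXW => cn l + 3 <= 6 * tp l + lc l
  | PYR => cn l + 2 <= 6 * tp l + lc l
  | PYW => cn l + 1 <= 6 * tp l + lc l
  | PXR => cn l <= 6 * tp l + lc l
  | PRaceW | PRaceR | PLose => cn l <= 6 * tp l + lc l + 1
  | PRet _ => cn l <= 6 * tp l + lc l + 2
  end.

Lemma reach_cost s : reach B s -> forall p l, lo s p = Some l -> cost l.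
Proof.
move=> rs p l h; suff: wf l && cost l by case/andP.
move: rs p l h; apply: reach_local => // p l x v /andP[wfl cl] al xB.
have -> /= : wf (delta B p l x v).
  move: wfl al; case: l {cl} => f t e g r st c k; rewrite /wf /delta /=.
  case: f => [||||||||||b] //=; rewrite /enter /active /=;
    repeat case: ifP => //=; try lia; by case: b.
move: wfl cl al; case: l => f t e g r st c k; rewrite /wf /cost /delta /=.
case: f => [||||||||||b] //=; rewrite /enter /active /=;
  repeat case: ifP => //=; lia.
Qed.

Lemma cost_bound s : reach B s -> forall p l, lo s p = Some l ->
  cn l <= 6 * tp l + lc l + 2.
Proof. by move=> rs p l /(reach_cost rs); rewrite /cost; case: (ph l); lia. Qed.

Definition written l : bool :=
  match ph l with PYR | PYW | PXR => true | _ => stp l end.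

(** The owner of the name in [RX i] would find it there and stop, so it never climbs past level [i].
    The first alternative is the time before the first write, when nobody has passed the level. *)
Definition inv_X s := forall i,
  (me s (RX i) = 0 /\ forall p l, lo s p = Some l ->
     tp l <= i.+1 /\ (tp l = i.+1 -> ~~ written l)) \/
  (exists p l, [/\ me s (RX i) = p.+1, lo s p = Some l & tp l = i.+1]).

Lemma reach_X s : reach B s -> inv_X s.
Proof.
elim=> {s} [|s p rs IH h|s p l x rs IH h al xB] i.
- by left.
- case: (IH i) => [[m0 hall]|[q [lq [mq hq tq]]]].
    by left; split=> // q lq /lo_setlP[[_ ->]|[_ /hall]].
  right; exists q, lq; split=> //; rewrite lo_setl_neq // => e.
  by rewrite e h in hq.
- have wfl := reach_wf rs h; rewrite (astepE B x h).
  have [[lX ->]|hm] : (ph l = PXW /\ i = (tp l).-1) \/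
      (me (setl s p (delta B p l x (memr (me s) (action p l x)))
        (memw (me s) (action p l x))) (RX i) = me s (RX i) /\
       (ph l = PXW -> tp l <> i.+1)).
    rewrite /= /memw /action; case: (ph l) => /=; try (by right; split).
      rewrite regE /=; case: eqP => [->|ne]; [by left|right].
      by split=> // _ ti; rewrite ti in ne.
    by right; split=> //; case: (x == 0).
    right; exists p; rewrite lo_setl_eq; eexists; split; [| by [] |].
      by rewrite /= /action lX /= eqxx.
    move: wfl lX; rewrite /wf; case: l {h al} => f t e g r st c k /= + ff.
    by rewrite ff /=; lia.
  case: hm => -> hX; case: (IH i) => [[m0 hall]|[q [lq [mq hq tq]]]].
    left; split=> // q lq /lo_setlP[[_ ->]|[_ /hall //]].
    have [t1 t2] := hall _ _ h; move: wfl t1 t2 hX al {h}.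
    case: l => f t e g r st c k; rewrite /wf /written /action /=.
    case: f => [||||||||||b] //=; rewrite /enter /active /=;
      repeat case: ifP => //=; try lia;
      by move=> ? ? ? /(_ erefl); lia.
  have [eqp|nqp] := eqVneq q p; last first.
    right; exists q, lq; split=> //; rewrite lo_setl_neq //; exact/eqP.
  right; exists p; rewrite lo_setl_eq; eexists; split; [by rewrite mq eqp|by []|].
  move: h; rewrite -eqp hq => -[lE]; move: wfl tq mq {hX al}; rewrite -lE eqp.
  case: lq {lE hq} => f t e g r st c k; rewrite /wf /action /=.
  case: f => [||||||||||b] //=; try (by case: ifP); try lia.
    by move=> wt tt mm; rewrite tt /= mm eqxx.
  by repeat case: ifP.
Qed.

Definition opened s i : {set 'I_n} :=
  [set p | if lo s p is Some l then i < tp l else false].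

Lemma openedP s i p : reflect (exists2 l, lo s p = Some l & i < tp l) (p \in opened s i).
Proof.
rewrite inE; case: (lo s p) => [l|]; last by constructor=> -[].
by apply: (iffP idP) => [|[_ [<-]]]; first by exists l.
Qed.

(** The process named in [RX i] stays at level [i]; if the register is blank, nobody has got further
    at all. *)
Lemma opened_lt s i : reach B s -> 0 < #|opened s i| ->
  #|opened s i.+1| < #|opened s i|.
Proof.
move=> rs /card_gt0P[p0 p0i]; apply: proper_card; apply/properP; split.
  by apply/fintype.subsetP => p /openedP[l h lt]; apply/openedP; exists l => //; lia.
case: (reach_X rs i) => [[_ hall]|[q [lq [_ hq tq]]]].
  exists p0 => //; apply/openedP => -[l /hall[]]; lia.
exists q; first by apply/openedP; exists lq => //; lia.
by apply/openedP => -[l]; rewrite hq => -[<-]; lia.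
Qed.

Lemma opened_add s i j : reach B s -> 0 < #|opened s (i + j)| ->
  #|opened s (i + j)| + j <= #|opened s i|.
Proof.
move=> rs; elim: j => [|j IH]; rewrite ?addn0 // addnS => h.
have h' : 0 < #|opened s (i + j)|.
  apply: leq_trans h (subset_leq_card _).
  by apply/fintype.subsetP => p /openedP[l hl lt]; apply/openedP; exists l => //; lia.
by have := opened_lt rs h'; have := IH h'; lia.
Qed.

Lemma opened_bound s i p l : reach B s -> lo s p = Some l -> i < tp l ->
  tp l <= i + #|opened s i|.
Proof.
move=> rs h lt.
have h0 : 0 < #|opened s (i + ((tp l).-1 - i))|.
  by apply/card_gt0P; exists p; apply/openedP; exists l => //; lia.
by have := opened_add rs h0; lia.
Qed.

Lemma tp_le_n s p l : reach B s -> lo s p = Some l -> tp l <= n.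
Proof.
move=> rs h; case: (posnP (tp l)) => [->//|t0].
apply: leq_trans (opened_bound rs h t0) _.
by rewrite add0n -[X in _ <= X]card_ord max_card.
Qed.

Definition upd (m : reg -> nat) r v := fun r' => if r' == r then v else m r'.

(** A normal form of [action] and [delta] on well-formed states, with levels written as successors
    and roles computed; the invariants below are proved by cases on it. *)
Variant step_spec p x (m : reg -> nat) : lst -> lst -> (reg -> nat) -> Prop :=
| SDoorShut e g r c k of 0 < m RDoor :
    step_spec p x m (Lst PDoor 0 e g r false c k) (Lst (PRet true) 0 e g r false c k.+1) m
| SDoorOpen f e g r c k of m RDoor = 0 & f = enter B 0 :
    step_spec p x m (Lst PDoor 0 e g r false c k) (Lst f 1 e g r false c k.+1) m
| SGrpW i e g r c k of i < B :
    step_spec p x m (Lst PGrpW i.+1 e g r false c k) (Lst PGrpR i.+1 e x r false c k.+1)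
      (upd m (RGrp i x) 1)
| SGrpLose i e g r c k of i < B & g < B & 0 < m (RGrp i g.+1) :
    step_spec p x m (Lst PGrpR i.+1 e g r false c k) (Lst PLose i.+1 e g r false c k.+1) m
| SGrpPass i e g r c k of i < B & g < B & m (RGrp i g.+1) = 0 :
    step_spec p x m (Lst PGrpR i.+1 e g r false c k) (Lst PXW i.+1 e g r false c k.+1) m
| SXW i e g r c k :
    step_spec p x m (Lst PXW i.+1 e g r false c k) (Lst PYR i.+1 e g r false c k.+1)
      (upd m (RX i) p.+1)
| SYLose i e g r c k of 0 < m (RY i) :
    step_spec p x m (Lst PYR i.+1 e g r false c k) (Lst PLose i.+1 e g r false c k.+1) m
| SYPass i e g r c k of m (RY i) = 0 :
    step_spec p x m (Lst PYR i.+1 e g r false c k) (Lst PYW i.+1 e g r false c k.+1) m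
| SYW i e g r c k :
    step_spec p x m (Lst PYW i.+1 e g r false c k) (Lst PXR i.+1 e g r false c k.+1)
      (upd m (RY i) 1)
| SStop i e g r c k of m (RX i) = p.+1 :
    step_spec p x m (Lst PXR i.+1 e g r false c k) (Lst PRaceW i.+1 i.+1 g 0 true c k.+1) m
| SRight f i e g r c k of m (RX i) <> p.+1 & f = enter B i.+1 :
    step_spec p x m (Lst PXR i.+1 e g r false c k) (Lst f i.+2 e g r false c k.+1) m
| SRaceInc t i g r c k of i < t & x = 0 :
    step_spec p x m (Lst PRaceW t i.+1 g r true c k) (Lst PRaceR t i.+1 g r.+1 true c.+1 k.+1)
      (upd m (RRace i (i.+1 != t)) r.+1)
| SRaceDummy t i g r c k of i < t & 0 < x :
    step_spec p x m (Lst PRaceW t i.+1 g r true c k) (Lst PRaceR t i.+1 g r true c.+1 k.+1)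
      (upd m RDummy r.+1)
| SRaceLose t i g r c k of i < t & r < m (RRace i (i.+1 == t)) :
    step_spec p x m (Lst PRaceR t i.+1 g r true c k) (Lst PLose t i.+1 g r true c.+1 k.+1) m
| SRaceWin t f i g r c k of i < t & (m (RRace i (i.+1 == t))).+2 <= r
    & f = (if i == 0 then PRet false else PRaceW) :
    step_spec p x m (Lst PRaceR t i.+1 g r true c k) (Lst f t i g 0 true c.+1 k.+1) m
| SRaceOn t i g r c k of i < t & m (RRace i (i.+1 == t)) <= r
    & r <= (m (RRace i (i.+1 == t))).+1 :
    step_spec p x m (Lst PRaceR t i.+1 g r true c k) (Lst PRaceW t i.+1 g r true c.+1 k.+1) m
| SShut t e g r b c k of 0 < t & b ==> (0 < e <= t) :
    step_spec p x m (Lst PLose t e g r b c k) (Lst (PRet true) t e g r b c k.+1)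
      (upd m RDoor 1).

Lemma stepP p x m l : wf l -> active l ->
  step_spec p x m l (delta B p l x (memr m (action p l x))) (memw m (action p l x)).
Proof.
case: l => f t e g r b c k; rewrite /wf /active /action.
case: f => [||||||||||b'] //=.
- by case/andP=> /eqP-> /negbTE-> _; case: posnP => h /=; constructor.
- by case: t => [//|i] /and3P[_ ? /negbTE->] _; constructor.
- case: t => [//|i] /and4P[_ ? ? /negbTE->] _.
  by case: posnP => h /=; constructor.
- by case: t => [//|i] /andP[_ /negbTE->] _; constructor.
- by case: t => [//|i] /andP[_ /negbTE->] _; case: posnP => h /=; constructor.
- by case: t => [//|i] /andP[_ /negbTE->] _; constructor.
- by case: t => [//|i] /andP[_ /negbTE->] _; case: eqP => h /=; constructor.
- case: e => [|i]; rewrite ?andbF // => /and3P[-> _ ?] _; rewrite /role /=.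
  by case: posnP => [->|] //=; constructor.
- case: e => [|i]; rewrite ?andbF // => /and3P[-> _ ?] _; rewrite /role /= negbK.
  case: ltnP => h1; first by constructor.
  by case: ltnP => h2; constructor.
- by move=> /andP[h1 h2] _; constructor.
Qed.

Lemma reachP (P : st n -> Prop) : P (st0 n) ->
  (forall s p, reach B s -> P s -> lo s p = None -> P (ainv p s)) ->
  (forall s p l l' m' x, reach B s -> P s -> lo s p = Some l -> wf l -> x < B ->
     step_spec p x (me s) l l' m' -> P (setl s p l' m')) ->
  forall s, reach B s -> P s.
Proof.
move=> P0 PI PS s; elim=> {s} [//|s p rs IH h|s p l x rs IH h al xB].
  exact: (PI _ _ rs IH h).
rewrite (astepE B x h); have wfl := reach_wf rs h.
by apply: (PS _ _ _ _ _ _ rs IH h wfl xB); apply: stepP.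
Qed.

Definition shut l := if ph l is PXR then true else stp l.

Definition inv_Y s := forall p l, lo s p = Some l -> shut l -> 0 < me s (RY (tp l).-1).

Lemma reach_Y s : reach B s -> inv_Y s.
Proof.
move: s; apply: reachP => [//|s p rs IH h|s p l l' m' x rs IH h wfl xB sp] q lq.
  by case/lo_setlP=> [[_ ->]|[_ /IH]].
have mono i : 0 < me s (RY i) -> 0 < m' (RY i).
  by case: sp => *; rewrite /upd ?regE //=; case: ifP.
case/lo_setlP => [[_ ->]|[_ hq]]; last by move=> /(IH _ _ hq) /mono.
have := IH _ _ h; move: mono; rewrite /shut.
case: sp => {h wfl} //= *; subst; rewrite /upd ?regE ?eqxx //=; eauto.
all: try by enter_tac.
all: by rewrite ?eqxx //; case: ifP.
Qed.

(** The second conjunct makes the first inductive. When [p] stops, [RX] holds its name and the gate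
    is closed: a rival already past the gate has lost its name and will not write it again, any
    other rival will be turned away. *)
Definition inv_S s := forall p q lp lq, lo s p = Some lp -> lo s q = Some lq ->
  p <> q -> stp lp -> tp lp = tp lq ->
  ~~ stp lq /\ (match ph lq with PYW | PXR => true | _ => false end ->
                 me s (RX (tp lp).-1) <> q.+1).

Lemma reach_S s : reach B s -> inv_S s.
Proof.
move: s; apply: reachP => [//|s p rs IH h|s p l l' m' x rs IH h wfl xB sp] q1 q2 l1 l2.
  by case/lo_setlP=> [[-> ->]|[n1 h1]] //; case/lo_setlP=> [[-> ->]|[n2 h2]] //=; apply: IH.
case/lo_setlP=> [[-> ->]|[n1 h1]]; case/lo_setlP=> [[-> ->]|[n2 h2]] //= ne //.
- move=> st1 tE; have A1 := IH p q2 _ _ h h2 ne; have A2 := IH q2 p _ _ h2 h (nesym ne).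
  move: A1 A2 ne st1 tE.
  case: sp {h wfl} => //=.
    (* Had [q2] stopped before, the hypothesis for the swapped pair would forbid [RX] to hold the
       name of [p]. *)
    move=> i e g r c k e1 A1 A2 ne st1 tE; split.
      by apply/negP => st2; case: (A2 st2 (esym tE)) => _ /(_ isT); rewrite -tE.
    by move=> _; rewrite e1 => -[] /val_inj.
  all: by move=> *; subst; rewrite /upd ?regE /=; intuition.
- move=> st1 tE; have : 0 < me s (RY (tp l').-1).
    by rewrite -tE; apply: (reach_Y rs h1); rewrite /shut; case: (ph l1).
  have := IH q1 p _ _ h1 h ne st1; rewrite tE; case: sp {h wfl tE} => //=.
  all: move=> *; subst; rewrite /upd ?regE /=.
  all: match goal with A : _ = _ -> _ /\ _, B : is_true (0 < _) |- _ =>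
    try (by enter_tac); have [A1 A2] := A erefl; try done; try (by lia) end.
- move=> st1 tE; have [A1 A2] := IH q1 q2 _ _ h1 h2 ne st1 tE; split=> // /A2 A3.
  case: sp {h wfl} => *; subst; rewrite /upd ?regE //=.
  by case: eqP => // _ [] /val_inj /esym.
Qed.

End Safety.

(** * At most one winner in each race *)

Section Race.
Variables (n B : nat).
Implicit Types (s : st n) (p q : 'I_n) (l : lst) (a : bool).

Definition won l i : bool := [&& stp l, le l <= i & i < tp l].
(** Stays true after the race is won or lost. In role [true] it coincides with [won l i.+1], so
    contestants are unique there by uniqueness of winners one level up, and in role [false] by the
    splitter. *)
Definition reached l i a : bool :=
  [&& stp l, le l <= i.+1 & if a then i.+1 < tp l else tp l == i.+1].

(** [R_lead] carries the proof: the register of a winner is frozen, and a rival about to write is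
    two behind, hence still behind after the write, so its next read makes it lose. The bound [1 <]
    covers a rival yet to arrive, whose register is 0. *)
Record inv_R s : Prop := InvR {
  R_won : forall i p q lp lq, lo s p = Some lp -> lo s q = Some lq ->
    won lp i -> won lq i -> p = q;
  R_val : forall i p l a, lo s p = Some l -> reached l i a -> le l = i.+1 ->
    me s (RRace i a) = rr l;
  R_zero : forall i a, (forall p l, lo s p = Some l -> ~~ reached l i a) ->
    me s (RRace i a) = 0;
  R_lead : forall i p l a, lo s p = Some l -> won l i -> a = (tp l != i.+1) ->
    [/\ 1 < me s (RRace i a), me s (RRace i (~~ a)) < me s (RRace i a) &
      forall q lq, lo s q = Some lq -> reached lq i (~~ a) -> le lq = i.+1 ->
        (if ph lq is PRaceW then true else false) ->
        (me s (RRace i (~~ a))).+2 <= me s (RRace i a)] }.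

Lemma reached_uniq s i a p q lp lq : inv_S s -> inv_R s ->
  lo s p = Some lp -> lo s q = Some lq -> reached lp i a -> reached lq i a -> p = q.
Proof.
move=> iS iR hp hq; case: a => rp rq.
  exact: (@R_won _ iR i.+1 p q lp lq).
have [//|/eqP ne] := eqVneq p q; case/and3P: rp => sp _ /eqP tp1.
case/and3P: rq => sq _ /eqP tq1.
by have [] := iS _ _ _ _ hp hq ne sp; rewrite ?sq // tp1 tq1.
Qed.

Lemma won_reached l i : won l i -> reached l i (tp l != i.+1).
Proof. by rewrite /won /reached; case: eqP => /= h /and3P[-> h1 h2]; lia. Qed.

Lemma reached_role l i a : reached l i a -> a = (tp l != i.+1).
Proof. by case/and3P => _ _; case: a => [|->//]; case: eqP => // ->; rewrite ltnn. Qed.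

Lemma won_other s i p q lp lq a : inv_S s -> inv_R s ->
  lo s p = Some lp -> lo s q = Some lq -> reached lp i a -> le lp = i.+1 ->
  won lq i -> [/\ a = ~~ (tp lq != i.+1), rr lp < me s (RRace i (~~ a)),
    1 < me s (RRace i (~~ a)) &
    (if ph lp is PRaceW then true else false) -> (rr lp).+2 <= me s (RRace i (~~ a))].
Proof.
move=> iS iR hp hq rp lep wq; have rq := won_reached wq.
have ea : a = ~~ (tp lq != i.+1).
  case: (a =P ~~ (tp lq != i.+1)) => // ne.
  have ea : (tp lq != i.+1) = a by move: ne; case: a {rp}; case: (tp lq != i.+1).
  rewrite ea in rq; have pq := reached_uniq iS iR hp hq rp rq.
  by move: hq wq; rewrite -pq hp => -[<-]; rewrite /won lep ltnn andbF.
have [h1 h2 h3] := R_lead iR hq wq erefl.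
have v := R_val iR hp rp lep; subst a; rewrite negbK -v; split=> //.
exact: h3 hp rp lep.
Qed.

Lemma reach_R s : reach B s -> inv_R s.
Proof.
move: s; apply: reachP => [|s p rs IH h|s p l l' m' x rs IH h wfl xB sp].
- by split=> // i p l a; discriminate.
- have w0 i : won lst0 i = false by [].
  have r0 i a : reached lst0 i a = false by [].
  split=> [i q1 q2 l1 l2|i q lq a|i a hr|i q lq a].
  + case/lo_setlP=> [[_ ->]|[_ h1]]; rewrite ?w0 //.
    case/lo_setlP=> [[_ ->]|[_ h2]]; rewrite ?w0 //; exact: (R_won IH h1 h2).
  + by case/lo_setlP=> [[_ ->]|[_ h1]]; rewrite ?r0 //; apply: (R_val IH h1).
  + apply: (R_zero IH) => q lq hq; apply: (hr q); rewrite lo_setl_neq // => e.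
    by rewrite e h in hq.
  + case/lo_setlP=> [[_ ->]|[_ h1]]; rewrite ?w0 // => wq ea.
    have [? ? h3] := R_lead IH h1 wq ea; split=> // q' lq'.
    by case/lo_setlP=> [[_ ->]|[_ h2]]; rewrite ?r0 //; apply: h3 h2.
- have iS := reach_S rs.
  have old q lq : lo s q = Some lq -> q = p -> lq = l by move=> hq e; move: hq; rewrite e h => -[].
  have mono i a : reached l i a -> reached l' i a.
    by rewrite /reached; case: a; case: sp {h wfl old} => //= *; lia.
  have memE i a : m' (RRace i a) = me s (RRace i a) \/
      [/\ ph l = PRaceW, ph l' = PRaceR, reached l i a, le l = i.+1 & le l' = i.+1] /\
      m' (RRace i a) = (rr l).+1 /\ rr l' = (rr l).+1.
    case: sp {h wfl old mono} => *; rewrite /upd ?regE /=; try by left.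
    case: andP => [[/eqP-> /eqP->]|_]; [right|by left].
    split=> //; split=> //; rewrite /reached /= leqnn /= eq_sym.
    by case: eqP => ? /=; lia.
  (* To win, [p] must read a value at least two below its own, but [won_other] puts the register of
     an earlier winner above that of [p]. *)
  have nowin i q lq : lo s q = Some lq -> ~~ won l i -> won l' i -> ~~ won lq i.
    move=> hq nw nw'; apply/negP => wq.
    have [ph1 le1 rl v2] : [/\ ph l = PRaceR, le l = i.+1, reached l i (tp l != i.+1)
        & (me s (RRace i (tp l == i.+1))) <= rr l].
      move: nw nw'; rewrite /won /reached.
      case: sp {h wfl old mono memE} => //=; try by move=> *; lia.
      move=> t f j g r c k jt v2 _ nw nw'; have ej : j = i by lia.
      subst j; rewrite eq_sym in v2; split=> //; last by lia.
      by case: eqP => ? /=; lia.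
    have [_ + _ _] := won_other iS IH h hq rl le1 wq.
    by rewrite negbK; lia.
  (* A contestant arrives by winning the race of the next level (role [true]) or by stopping in the
     splitter (role [false]); either way the role was vacant. *)
  have newreach i a : reached l' i a -> ~~ reached l i a ->
      [/\ le l' = i.+1, rr l' = 0 & forall q lq, lo s q = Some lq -> ~~ reached lq i a].
    move=> r' nr; suff [le' rr' hq] : [/\ le l' = i.+1, rr l' = 0 &
        (a = true) \/ [/\ a = false, stp l = false, tp l = i.+1, ph l = PXR & me s (RX i) = p.+1]].
      split=> // q lq hlq; case: hq => [e|[ea st0 tp1 phX mX]]; subst a.
        exact: (nowin i.+1 _ _ hlq).
      apply/negP => /and3P[stq leq /eqP tpq].
      have [e|ne] := eqVneq q p; first by rewrite (old _ _ hlq e) st0 in stq.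
      have [_] := iS _ _ _ _ hlq h (elimN eqP ne) stq (etrans tpq (esym tp1)).
      by rewrite phX tpq; apply.
    move: r' nr; rewrite /reached.
    case: sp {h wfl old mono memE nowin} => //=; try by (case: a; move=> *; lia).
      move=> i0 e g r c k mX; case: a => /= h1 h2; [lia|have ei : i0 = i by lia].
      by subst i0; split=> //; right.
    by move=> t f i0 g r c k it v2 _; case: a => /= *; split; try lia; left.
  have lele : stp l -> le l' <= le l.
    by case: sp {h wfl old mono memE nowin newreach} => //=.
  have contR i a : reached l i a -> le l' = i.+1 -> m' (RRace i a) = me s (RRace i a) ->
      rr l' = rr l.
    move=> r1 le1 mm; have v := R_val IH h r1; have ea := reached_role r1; subst a.
    move: r1 le1 mm v; case: sp {h wfl old mono memE nowin newreach lele} => //=.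
      move=> t j g r c k jt x0 r1 [ej]; subst j; rewrite /upd (eq_sym t) eqxx => mE /(_ erefl) v.
      by rewrite -mE in v; lia.
    move=> t f j g r c k jt v2 fE; rewrite /reached /=; case: eqP; lia.
  have notW i a : reached l i a -> le l = i.+1 -> le l' = i.+1 ->
      (if ph l' is PRaceW then true else false) -> me s (RRace i (~~ a)) <= rr l.
    move=> r1; rewrite (reached_role r1) negbK; case/and3P: r1 => + _ _.
    case: sp {h wfl old mono memE nowin newreach lele contR} => //=; try (by move=> *; lia);
      try by (move=> *; subst; enter_tac).
    by move=> t j g r c k jt v1 v2 _ [ej] _ _; subst j; rewrite eq_sym.
  split.
  + move=> i q1 q2 l1 l2.
    case/lo_setlP=> [[-> ->]|[n1 h1]]; case/lo_setlP=> [[-> ->]|[n2 h2]] // w1 w2.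
    * case: (boolP (won l i)) => w; first exact: (R_won IH h h2 w w2).
      by rewrite (negbTE (nowin _ _ _ h2 w w1)) in w2.
    * case: (boolP (won l i)) => w; first exact: (R_won IH h1 h w1 w).
      by rewrite (negbTE (nowin _ _ _ h1 w w2)) in w1.
    * exact: (R_won IH h1 h2 w1 w2).
  + move=> i q lq a /lo_setlP[[_ ->]|[nq hq]] rq leq /=.
      case: (boolP (reached l i a)) => r1.
        case: (memE i a) => [mE|[_ [-> ->]]] //.
        rewrite mE (contR _ _ r1 leq mE); apply: (R_val IH h r1).
        by case/and3P: r1 => /lele; lia.
      have [_ -> hz] := newreach _ _ rq r1; case: (memE i a) => [->|[[_ _ r2]]].
        exact: (R_zero IH).
      by rewrite r2 in r1.
    case: (memE i a) => [->|[[_ _ r2 _ _] _]]; first exact: (R_val IH hq rq leq).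
    by case: nq; apply: reached_uniq iS IH hq h rq r2.
  + move=> i a hz /=; have hz' q lq : lo s q = Some lq -> ~~ reached lq i a.
      move=> hq; have [e|/eqP ne] := eqVneq q p.
        rewrite (old _ _ hq e); apply: contra (@mono i a) _; apply: (hz p).
        exact: lo_setl_eq.
      by apply: (hz q); rewrite lo_setl_neq.
    case: (memE i a) => [->|[[_ _ r2 _ _] _]]; first exact: (R_zero IH).
    by rewrite (negbTE (hz' _ _ h)) in r2.
  + move=> i q lq a /lo_setlP[[_ ->]|[nq hq]] wq ea; rewrite [me _]/=.
      case: (boolP (won l i)) => w.
        have mE b : m' (RRace i b) = me s (RRace i b).
          by case: (memE i b) => // -[[_ _ _ e _]]; move: w; rewrite /won e ltnn andbF.
        have tE : tp l' = tp l by move: w; rewrite /won; case: sp {h wfl old mono memE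
          nowin newreach lele contR notW mE wq ea} => //=.
        rewrite tE in ea; have [h1 h2 h3] := R_lead IH h w ea; rewrite !mE; split=> // q0 l0.
        case/lo_setlP=> [[_ ->]|[_ h0]]; last exact: h3 h0.
        by move=> _ e; move: wq; rewrite /won e ltnn andbF.
      have [mE le1 v2 vE] : [/\ forall b, m' (RRace i b) = me s (RRace i b),
          le l = i.+1, (me s (RRace i (~~ a))).+2 <= rr l & reached l i a].
        rewrite ea negbK; move: w wq; rewrite /won /reached.
        case: sp {h wfl old mono memE nowin newreach lele contR notW ea} => //=;
          try by move=> *; lia.
        move=> t f j g r c k jt v2 _ w wq; have ej : j = i by lia.
        by subst j; rewrite (eq_sym t); split=> //; case: eqP => ? /=; lia.
      have v := R_val IH h vE le1; rewrite !mE v; split; lia.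
    have [h1 h2 h3] := R_lead IH hq wq ea.
    have rq := won_reached wq; rewrite -ea in rq.
    have -> : m' (RRace i a) = me s (RRace i a).
      by case: (memE i a) => // -[[_ _ r2 _ _] _]; case: nq; apply: reached_uniq iS IH hq h rq r2.
    case: (memE i (~~ a)) => [->|[[w w' r2 le1 le2] [-> _]]]; split=> //.
    * move=> q0 l0 /lo_setlP[[_ ->]|[_ h0]]; last exact: h3 h0.
      move=> r' le' w'; case: (boolP (reached l i (~~ a))) => r1.
        have le1 : le l = i.+1 by case/and3P: r1 => /lele; lia.
        have := notW _ _ r1 le1 le' w'; rewrite negbK.
        by rewrite -(R_val IH h r1 le1); lia.
      have [_ _ hz] := newreach _ _ r' r1.
      by rewrite (R_zero IH hz).
    * by have := h3 _ _ h r2 le1; rewrite w (R_val IH h r2 le1) => /(_ isT).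
    * move=> q0 l0 /lo_setlP[[_ ->]|[n0 h0]]; first by rewrite w'.
      by move=> r0; case: n0; apply: reached_uniq iS IH h0 h r0 r2.
Qed.

End Race.

(** * Somebody never loses *)

Section Rank.
Variables (n B : nat).
Implicit Types (s : st n) (p q : 'I_n) (l : lst) (u v w : nat * nat).

Definition lexle u v : bool := (u.1 < v.1) || ((u.1 == v.1) && (u.2 <= v.2)).
Definition lexlt u v : bool := (u.1 < v.1) || ((u.1 == v.1) && (u.2 < v.2)).

(* The first component grows along the levels and then along the races, which
   are run from high to low levels; [RRace i _] is ordered by its value. *)
Definition rank l : nat * nat :=
  match ph l with
  | PGrpW => ((tp l).-1.*2, 0)
  | PGrpR => ((tp l).-1.*2, (gx l).+1)
  | PXW | PYR | PYW => ((tp l).-1.*2.+1, 0)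
  | PXR => ((tp l).-1.*2.+1, 1)
  | PRaceW | PRaceR => (n.*2 + (n - le l), rr l)
  | PRet false => (n.*2 + n, 0)
  | _ => (0, 0)
  end.

Definition mark (r : reg) (v : nat) : option (nat * nat) :=
  match r with
  | RDoor => Some (0, 0)
  | RGrp i x => Some (i.*2, x.+1)
  | RY i => Some (i.*2.+1, 1)
  | RRace i _ => Some (n.*2 + (n - i.+1), v)
  | _ => None
  end.

Definition has_rank s u := exists p l, [/\ lo s p = Some l, nonlost l & lexle u (rank l)].

(** [M_entered] serves the mark of the door: it is written by a process that has lost and cannot be
    its own witness. *)
Record inv_M s : Prop := InvM {
  M_mark : forall r u, 0 < me s r -> mark r (me s r) = Some u -> has_rank s u;
  M_entered : forall p l, lo s p = Some l -> 0 < tp l -> has_rank s (0, 0) }.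

Lemma lexle0 u : lexle (0, 0) u.
Proof. by rewrite /lexle; case: u => [[|a] b]. Qed.

(** If the witness of a mark loses, it has just read a mark of strictly larger rank. The witness of
    that mark outranks the loser, so it is another process and takes over. *)
Lemma reach_M s : reach B s -> inv_M s.
Proof.
move: s; apply: reachP => [|s p rs IH h|s p l l' m' x rs IH h wfl xB sp].
- by split.
- have old u : has_rank s u -> has_rank (ainv p s) u.
    case=> q [lq [hq nl le]]; exists q, lq; split=> //; rewrite lo_setl_neq // => e.
    by rewrite e h in hq.
  split=> [r u /= h1 h2|q lq]; first by apply: old; apply: M_mark IH _ _ h1 h2.
  by case/lo_setlP => [[_ ->]|[_ hq]] // /(M_entered IH hq) /old.
- have tn := tp_le_n rs h.
  have fate : (nonlost l -> nonlost l' /\ lexle (rank l) (rank l')) \/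
      m' = me s /\ exists r u, [/\ 0 < me s r, mark r (me s r) = Some u & lexlt (rank l) u].
    case: sp tn {h wfl} => /= *; rewrite /nonlost /rank /lexle /lexlt /=.
    all: try by left; subst; enter_tac => /=; lia.
    all: try by right; split=> //; match goal with H : is_true (_ < me _ ?r) |- _ =>
      exists r; rewrite /=; eexists; split; [lia|by []|rewrite /=; lia] end.
  have old u : has_rank s u -> has_rank (setl s p l' m') u.
    case=> q [lq [hq nl leu]]; have [e|/eqP ne] := eqVneq q p; last first.
      by exists q, lq; split=> //; rewrite lo_setl_neq.
    move: hq; rewrite e h => -[E]; subst lq.
    case: fate => [/(_ nl)[nl' le']|[_ [r [v [h1 h2 lv]]]]].
      exists p, l'; split=> //; first exact: lo_setl_eq.
      by move: leu le'; rewrite /lexle; lia.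
    have [q' [lq' [hq' nl' le']]] := M_mark IH h1 h2.
    have ne : q' <> p.
      move=> e'; move: hq'; rewrite e' h => -[E]; subst lq'.
      by move: lv le'; rewrite /lexle /lexlt; lia.
    exists q', lq'; split; rewrite ?lo_setl_neq //.
    by move: leu lv le'; rewrite /lexle /lexlt; lia.
  split=> [r u /=|q lq].
  + have [E|ne] := eqVneq (m' r) (me s r).
      by rewrite E => h1 h2; apply/old/(M_mark IH h1 h2).
    move=> _ mk; have : (nonlost l' /\ lexle u (rank l')) \/ u = (0, 0) /\ 0 < tp l.
    { move: ne mk; case: sp tn {h wfl fate old} => *; rewrite /nonlost /rank /lexle.
      all: match goal with H : is_true (_ != _), K : mark _ _ = _ |- _ => move: H K end; rewrite /upd ?eqxx //.
      all: match goal with |- context [if ?y == ?z then _ else _] =>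
        case: (y =P z) => [->|]; rewrite ?eqxx //= end.
      all: try by move=> _ [<-] /=; left; lia.
      all: try by [].
      by move=> _ [<-]; right. }
    case=> [[nl' le']|[-> t0]]; last exact/old/(M_entered IH h).
    by exists p, l'; split=> //; apply: lo_setl_eq.
  + case/lo_setlP=> [[_ ->] t0|[_ hq] /(M_entered IH hq)/old //].
    case: (posnP (tp l)) => [t1|]; last by move=> /(M_entered IH h)/old.
    exists p, l'; split; rewrite ?lexle0 ?lo_setl_eq // /nonlost t0 /=.
    move: t0 t1; case: sp {h wfl fate old tn} => //=; try by move=> *; lia.
    by move=> *; subst; enter_tac.
Qed.

Lemma exists_nonlost s p l : reach B s -> lo s p = Some l -> 0 < tp l \/ 0 < me s RDoor ->
  exists q lq, lo s q = Some lq /\ nonlost lq.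
Proof.
move=> rs h; suff: (0 < tp l \/ 0 < me s RDoor -> has_rank s (0, 0)).
  by move=> hr /hr[q [lq [hq nl _]]]; exists q, lq.
case; first exact: (M_entered (reach_M rs) h).
by move/(M_mark (reach_M rs)); apply.
Qed.

Lemma winner_uniq s p q lp lq : reach B s -> lo s p = Some lp -> lo s q = Some lq ->
  ph lp = PRet false -> ph lq = PRet false -> p = q.
Proof.
move=> rs hp hq rp rq; have wp := reach_wf rs hp; have wq := reach_wf rs hq.
apply: (R_won (reach_R rs) (i := 0) hp hq); rewrite /won.
  by move: wp; rewrite /wf rp; lia.
by move: wq; rewrite /wf rq; lia.
Qed.

Lemma loser_shut s p l : reach B s -> lo s p = Some l -> ph l = PRet true ->
  0 < me s RDoor.
Proof.
move=> rs; move: s rs p l.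
apply: (@reachP n B (fun s => forall p l, lo s p = Some l -> ph l = PRet true -> 0 < me s RDoor))
  => [|s p rs IH h|s p l l' m' x rs IH h wfl xB sp] q lq //.
  by case/lo_setlP=> [[_ ->]|[_ hq]] //; apply: IH hq.
have mono : 0 < me s RDoor -> 0 < m' RDoor.
  by case: sp => *; rewrite /upd ?regE //=.
case/lo_setlP => [[_ ->]|[_ hq]]; last by move=> /(IH _ _ hq) /mono.
case: sp {h wfl mono} => //= *; subst; try by enter_tac.
by match goal with H : context [if _ then _ else _] |- _ => move: H; case: ifP end.
Qed.

End Rank.

(** * Potential of the races *)

Section RacePotential.
Variables (n B : nat).
Implicit Types (s : st n) (p q : 'I_n) (l : lst) (a : bool).

Variant rstat := RW | RR | RWon | RDead.

(* Expected number of remaining steps in a race whose other contestant has lost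
   ([mine] and [other] are the two register values).  The constants here and in
   [ahead] and [race_pot] solve the inequalities [race_pot_write], [race_pot_on],
   [race_pot_lose] and [race_pot_win]. *)
Definition alone (mine other : nat) (x : rstat) : nat :=
  match x with
  | RW => if mine < other then 10 else if mine == other then 8
          else if mine == other.+1 then 4 else 2
  | RR => if mine <= other then 9 else if mine == other.+1 then 5 else 1
  | _ => 0
  end.

Definition finish (x : rstat) : nat := match x with RW => 2 | RR => 1 | _ => 0 end.

Definition ahead (ra rb : nat) (x y : rstat) : nat :=
  match x, y with
  | _, RR => (alone ra rb x).+1
  | RR, _ => if ra == rb.+1 then 13 else 5
  | _, _ => if ra == rb.+1 then 12 else 6
  end.

(* A contestant that has not arrived yet counts as [RW] with register 0, hence
   arrivals do not change the potential. *)
Definition race_pot (ra rb : nat) (x y : rstat) : nat :=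
  match x, y with
  | RWon, z | z, RWon => finish z
  | RDead, z => alone rb ra z
  | z, RDead => alone ra rb z
  | _, _ =>
    if ra == rb then match x, y with RW, RW => 16 | RR, RR => 18 | _, _ => 17 end
    else if ra < rb then ahead rb ra y x else ahead ra rb x y
  end.

Lemma race_potC ra rb x y : race_pot ra rb x y = race_pot rb ra y x.
Proof.
rewrite /race_pot eq_sym; case: x; case: y => //=; case: eqP => //= ne;
  by have [h|h|h] := ltngtP ra rb => //; case: ne.
Qed.

(** The race coin is fair, so the sum over advancing and writing to the dummy is twice the average,
    and the 2 pays for the step in both branches. Doubling keeps everything in [nat]. *)
Lemma race_pot_write ra rb y :
  2 + race_pot ra.+1 rb RR y + race_pot ra rb RR y <= 2 * race_pot ra rb RW y.
Proof.
rewrite /race_pot /ahead /alone /finish; case: y.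
all: by repeat (case: ifP => /=); lia.
Qed.

(** Against a winner [finish] leaves no room for another round; reachable states never need it,
    because such a contestant reads a larger value and loses. *)
Lemma race_pot_on ra rb y : rb <= ra -> ra <= rb.+1 -> y <> RWon ->
  1 + race_pot ra rb RW y <= race_pot ra rb RR y.
Proof.
rewrite /race_pot /ahead /alone /finish; case: y => // h1 h2 _.
all: by repeat (case: ifP => /=); lia.
Qed.

Lemma race_pot_lose ra rb y : ra < rb ->
  1 + race_pot ra rb RDead y <= race_pot ra rb RR y.
Proof.
rewrite /race_pot /ahead /alone /finish; case: y => // h1.
all: by repeat (case: ifP => /=); lia.
Qed.

Lemma race_pot_win ra rb y : rb.+2 <= ra ->
  1 + race_pot ra rb RWon y <= race_pot ra rb RR y.
Proof.
rewrite /race_pot /ahead /alone /finish; case: y => // h1.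
all: by repeat (case: ifP => /=); lia.
Qed.

Definition stat_of l i : rstat :=
  if le l <= i then RWon else
  match ph l with PRaceR => RR | PLose | PRet _ => RDead | _ => RW end.

Definition stat s i a : rstat :=
  if [pick p | if lo s p is Some l then reached l i a else false] is Some p then
    if lo s p is Some l then stat_of l i else RW
  else RW.

Lemma statE s i a p l : inv_S s -> inv_R s -> lo s p = Some l -> reached l i a ->
  stat s i a = stat_of l i.
Proof.
move=> iS iR h r; rewrite /stat; case: pickP => [q|/(_ p)]; last by rewrite h r.
case hq: (lo s q) => [lq|//] rq; have e := reached_uniq iS iR h hq r rq.
by move: hq; rewrite -e h => -[->].
Qed.

Lemma stat_none s i a : (forall p l, lo s p = Some l -> ~~ reached l i a) ->
  stat s i a = RW.
Proof.
move=> hr; rewrite /stat; case: pickP => // q; case hq: (lo s q) => [lq|//].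
by rewrite (negbTE (hr _ _ hq)).
Qed.

(** Only the old local state decides: if [p] arrives at race [i] by this very step, its status is
    [RW], which already stood for the missing contestant. *)
Lemma stat_setl s p l l' m' x i a : reach B s -> reach B (setl s p l' m') ->
  lo s p = Some l -> step_spec B p x (me s) l l' m' ->
  stat (setl s p l' m') i a = if reached l i a then stat_of l' i else stat s i a.
Proof.
move=> rs rs' h sp; have [iS iR] := (reach_S rs, reach_R rs).
have [iS' iR'] := (reach_S rs', reach_R rs').
have h' : lo (setl s p l' m') p = Some l' by exact: lo_setl_eq.
case: (boolP (reached l i a)) => r.
  apply: (statE iS' iR' h'); move: r; rewrite /reached.
  by case: a; case: sp {h h' rs' iS' iR'} => //= *; lia.
case: (boolP (reached l' i a)) => r'.
  rewrite (statE iS' iR' h' r') stat_none.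
    move: r r'; rewrite /reached /stat_of.
    case: a; case: sp {h' rs' iS' iR' h} => //=;
      move=> *; subst; (case: ifP => h1; [exfalso; lia|]); by rewrite ?ifF //; lia.
  move=> q lq hq; have [e|/eqP ne] := eqVneq q p.
    by move: hq; rewrite e h => -[<-].
  apply/negP => rq; apply: (ne); apply: (reached_uniq iS' iR' _ h' rq r').
  by rewrite lo_setl_neq.
rewrite /stat; set P := (fun q => _); set Q := (fun q => if lo s q is Some _ then _ else _).
have PQ : P =1 Q.
  move=> q; rewrite /P /Q lo_setl; case: eqP => [->|//].
  by rewrite h (negbTE r) (negbTE r').
rewrite (eq_pick PQ); case: pickP => // q; rewrite /Q lo_setl; case: eqP => [->|//].
by rewrite h (negbTE r).
Qed.

Definition lam s i : nat :=
  race_pot (me s (RRace i false)) (me s (RRace i true)) (stat s i false) (stat s i true).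

(** All [n] races are counted, including those never reached; an untouched race holds its initial
    16, and [potential] subtracts these again. *)
Definition race_total s : nat :=
  \sum_p (if lo s p is Some l then lc l else 0) + \sum_(i < n) lam s i.

Lemma lamE s i a : lam s i =
  race_pot (me s (RRace i a)) (me s (RRace i (~~ a))) (stat s i a) (stat s i (~~ a)).
Proof. by case: a => //; apply: race_potC. Qed.

Lemma lam_16 s i : reach B s -> (forall p l, lo s p = Some l -> tp l <= i) ->
  lam s i = 16.
Proof.
move=> rs htp; have nr a p l : lo s p = Some l -> ~~ reached l i a.
  by move=> /htp ht; apply/negP => /and3P[_ _]; case: a; lia.
have iR := reach_R rs; rewrite /lam !stat_none ?(R_zero iR) // => p l; exact: nr.
Qed.

Lemma race_total_invoke s p : lo s p = None -> race_total (ainv p s) = race_total s.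
Proof.
move=> h; rewrite /race_total; congr (_ + _).
  by apply: eq_bigr => q _; rewrite lo_setl; case: eqP => [->|//]; rewrite h.
apply: eq_bigr => i _; rewrite /lam; have stE a : stat (ainv p s) i a = stat s i a.
  rewrite /stat; set P := (fun q => _); set Q := (fun q => if lo s q is Some _ then _ else _).
  have PQ : P =1 Q by move=> q; rewrite /P /Q lo_setl; case: eqP => [->|//]; rewrite h.
  by rewrite (eq_pick PQ); case: pickP => // q; rewrite /Q lo_setl; case: eqP => [->|//]; rewrite h.
by rewrite !stE.
Qed.

Lemma lc_sum_setl s p l l' m' : lo s p = Some l ->
  \sum_q (if lo (setl s p l' m') q is Some l then lc l else 0) + lc l =
  \sum_q (if lo s q is Some l then lc l else 0) + lc l'.
Proof.
move=> h; rewrite (bigD1 p) //= eqxx [in RHS](bigD1 p) //= h.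
rewrite [X in _ + X + _ = _](eq_bigr (fun q => if lo s q is Some l then lc l else 0)); first lia.
by move=> q /negbTE ->.
Qed.

Lemma lam_keep s p l l' m' x i : reach B s -> reach B (setl s p l' m') ->
  lo s p = Some l -> step_spec B p x (me s) l l' m' ->
  (forall a, reached l i a -> stat_of l' i = stat_of l i) ->
  (forall a, m' (RRace i a) = me s (RRace i a)) ->
  lam (setl s p l' m') i = lam s i.
Proof.
move=> rs rs' h sp hs hm; rewrite /lam [me (setl _ _ _ _)]/= !hm.
have stE a : stat (setl s p l' m') i a = stat s i a.
  rewrite (stat_setl _ _ rs rs' h sp); case: (boolP (reached l i a)) => // r.
  by rewrite (hs _ r) (statE (reach_S rs) (reach_R rs) h r).
by rewrite !stE.
Qed.

Lemma step_race_mem p x m l l' m' j b : step_spec B p x m l l' m' ->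
  stp l -> j != (le l).-1 -> m' (RRace j b) = m (RRace j b).
Proof.
case=> //=; try by move=> *; rewrite /upd ?regE.
by move=> t i g r c k it x0 _ /negbTE ne; rewrite /upd regE /= ne.
Qed.

Lemma step_le p x m l l' m' : step_spec B p x m l l' m' -> stp l -> le l' <= le l.
Proof. by case=> //=. Qed.

(** In every other race that [p] has reached it is already the winner, so neither status nor
    register changes there. *)
Lemma lam_race s p t i l' m' x f g r c k : reach B s -> reach B (setl s p l' m') ->
  let l := Lst f t i.+1 g r true c k in i < t -> 
  lo s p = Some l -> step_spec B p x (me s) l l' m' ->
  let a := i.+1 != t in
  [/\ lam s i = race_pot r (me s (RRace i (~~ a))) (stat_of l i) (stat s i (~~ a)),
     lam (setl s p l' m') i = race_pot (m' (RRace i a)) (m' (RRace i (~~ a)))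
       (stat_of l' i) (stat s i (~~ a)) &
     forall j : 'I_n, j != i :> nat -> lam (setl s p l' m') j = lam s j].
Proof.
move=> rs rs' l it h sp a; have ra : reached l i a.
  by rewrite /reached /= leqnn /a eq_sym; case: eqP => ? /=; lia.
have rna : ~~ reached l i (~~ a) by apply/negP => /reached_role; rewrite /a eq_sym; case: eqP.
have iR := reach_R rs; split.
- by rewrite (lamE s i a) (R_val iR h ra erefl) (statE (reach_S rs) iR h ra).
- by rewrite (lamE _ i a) !(stat_setl _ _ rs rs' h sp) ra (negbTE rna).
- move=> j ne; apply: (lam_keep rs rs' h sp) => [b rb|b].
    have lt : i.+1 <= j by move: rb ne; rewrite /reached /=; lia.
    rewrite /stat_of /= lt; have -> // : le l' <= j.
    by apply: leq_trans lt; apply: (step_le sp).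
  exact: (step_race_mem b sp).
Qed.

Lemma race_total_setl s p l l' m' : lo s p = Some l ->
  race_total (setl s p l' m') + lc l =
  \sum_q (if lo s q is Some l then lc l else 0) + lc l' +
  \sum_(i < n) lam (setl s p l' m') i.
Proof. by move=> h; have := lc_sum_setl l' m' h; rewrite /race_total; lia. Qed.

Lemma lam_sum s s' (i : 'I_n) : (forall j : 'I_n, j != i :> nat -> lam s' j = lam s j) ->
  \sum_(j < n) lam s' j + lam s i = \sum_(j < n) lam s j + lam s' i.
Proof.
move=> hj; rewrite (bigD1 i) //= [in RHS](bigD1 i) //=.
by rewrite (eq_bigr (fun j : 'I_n => lam s j)) => [|j ne]; [lia|apply: hj].
Qed.

Lemma race_total_diff s p l l' m' i : lo s p = Some l -> i < n ->
  (forall j : 'I_n, j != i :> nat -> lam (setl s p l' m') j = lam s j) ->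
  race_total (setl s p l' m') + lc l + lam s i =
  race_total s + lc l' + lam (setl s p l' m') i.
Proof.
move=> h i_n hj; have := @lam_sum s _ (Ordinal i_n) hj.
by have := race_total_setl l' m' h; rewrite {3}/race_total /=; lia.
Qed.

Lemma race_total_step s p x l l' m' : reach B s -> reach B (setl s p l' m') ->
  lo s p = Some l -> step_spec B p x (me s) l l' m' ->
  (if ph l is PRaceW then false else true) ->
  race_total (setl s p l' m') <= race_total s.
Proof.
move=> rs rs' h sp nW; have tn := tp_le_n rs h.
have keep : lc l' = lc l -> (forall i a, reached l i a -> stat_of l' i = stat_of l i) ->
    (forall i a, m' (RRace i a) = me s (RRace i a)) ->
    race_total (setl s p l' m') <= race_total s.
  move=> hl hr hm; have := race_total_setl l' m' h; rewrite hl.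
  have -> : \sum_(i < n) lam (setl s p l' m') i = \sum_(i < n) lam s i.
    apply: eq_bigr => i _; apply: (lam_keep rs rs' h sp) => a; [exact: hr|exact: hm].
  by rewrite /race_total; lia.
move: (sp) rs' h keep tn nW; case: sp => //=.
all: try by move=> * ; match goal with K : _ = _ -> _ -> _ -> is_true _ |- _ =>
  apply: K => // *; rewrite /upd ?regE // end.
- move=> t i g r c k it rv sp rs' h _ tn _.
  have [l1 l2 l3] := lam_race rs rs' it h sp.
  have := race_total_diff h (leq_trans it tn) l3.
  rewrite l1 l2 (R_val (reach_R rs) h (a := i.+1 != t)) //=; last first.
    by rewrite /reached /= leqnn eq_sym; case: eqP => ? /=; lia.
  rewrite /stat_of /= ltnn negbK.
  by have := race_pot_lose (stat s i (i.+1 == t)) rv; lia.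
- move=> t f i g r c k it rv _ sp rs' h _ tn _.
  have [l1 l2 l3] := lam_race rs rs' it h sp.
  have := race_total_diff h (leq_trans it tn) l3.
  rewrite l1 l2 (R_val (reach_R rs) h (a := i.+1 != t)) //=; last first.
    by rewrite /reached /= leqnn eq_sym; case: eqP => ? /=; lia.
  rewrite /stat_of /= ltnn leqnn negbK.
  by have := race_pot_win (stat s i (i.+1 == t)) rv; lia.
- move=> t i g r c k it v1 v2 sp rs' h _ tn _.
  have [l1 l2 l3] := lam_race rs rs' it h sp.
  have ra : reached (Lst PRaceR t i.+1 g r true c k) i (i.+1 != t).
    by rewrite /reached /= leqnn eq_sym; case: eqP => ? /=; lia.
  have := race_total_diff h (leq_trans it tn) l3.
  rewrite l1 l2 (R_val (reach_R rs) h ra) //= /stat_of /= ltnn negbK.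
  (* The value read is at most that of [p], whereas by [won_other] a winning rival would have a
     larger one. *)
  have nw : stat s i (i.+1 == t) <> RWon.
    rewrite /stat; case: pickP => // q; case hq: (lo s q) => [lq|//] rq.
    rewrite /stat_of; case: ifP => [leq|_]; last by case: (ph lq).
    have wq : won lq i by move: rq leq; rewrite /reached /won => /and3P[-> _] /=; case: ifP; lia.
    have [_ + _ _] := won_other (reach_S rs) (reach_R rs) h hq ra erefl wq.
    by rewrite negbK /=; lia.
  by have := race_pot_on v1 v2 nw; lia.
Qed.

Lemma race_total_write s p t i g r c k (m1 m2 : reg -> nat) :
  let l := Lst PRaceW t i.+1 g r true c k in
  let s1 := setl s p (Lst PRaceR t i.+1 g r.+1 true c.+1 k.+1) m1 in
  let s2 := setl s p (Lst PRaceR t i.+1 g r true c.+1 k.+1) m2 in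
  reach B s -> reach B s1 -> reach B s2 -> lo s p = Some l -> i < t ->
  m1 = upd (me s) (RRace i (i.+1 != t)) r.+1 -> m2 = upd (me s) RDummy r.+1 ->
  race_total s1 + race_total s2 <= 2 * race_total s.
Proof.
move=> l s1 s2 rs rs1 rs2 h it em1 em2; have tn := tp_le_n rs h.
have sp1 : step_spec B p 0 (me s) l (Lst PRaceR t i.+1 g r.+1 true c.+1 k.+1) m1.
  by rewrite em1; apply: SRaceInc.
have sp2 : step_spec B p 1 (me s) l (Lst PRaceR t i.+1 g r true c.+1 k.+1) m2.
  by rewrite em2; apply: SRaceDummy.
have ra : reached l i (i.+1 != t).
  by rewrite /reached /= leqnn eq_sym; case: eqP => ? /=; lia.
have [l1 l2 l3] := lam_race rs rs1 it h sp1.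
have [k1 k2 k3] := lam_race rs rs2 it h sp2.
have := race_total_diff h (leq_trans it tn) l3.
have := race_total_diff h (leq_trans it tn) k3.
rewrite l1 l2 k2 /s1 /s2 em1 em2 /upd eqxx !regE /= eqxx /= (R_val (reach_R rs) h ra) //=.
have -> : ((~~ (i.+1 != t)) == (i.+1 != t)) = false by case: (i.+1 == t).
rewrite /stat_of /= ltnn negbK.
by have := race_pot_write r (me s (RRace i (i.+1 == t))) (stat s i (i.+1 == t)); lia.
Qed.

End RacePotential.

(** * Executions of the implementation *)

Section Executions.
Variables (n m : nat) (I : impl n m) (M : malg n).
Implicit Types (e : exec n) (p q : 'I_n).
Local Notation cfg := (Defs.cfg I M).
Local Notation elog := (Defs.elog I M).
Local Notation valid := (Defs.valid I M).
Local Notation next := (Defs.next I M).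
Local Notation step := (Defs.step I M).

Lemma run_from_cat c e e' : run_from I M c (e ++ e') =
  ((run_from I M (run_from I M c e).1 e').1,
   (run_from I M c e).2 ++ (run_from I M (run_from I M c e).1 e').2).
Proof.
elim: e c => [|[p k] e IH] c /=; first by case: (run_from I M c e').
by rewrite IH.
Qed.

Lemma valid_from_cat c e e' : valid_from I M c (e ++ e') =
  valid_from I M c e && valid_from I M (run_from I M c e).1 e'.
Proof. by elim: e c => [|[p k] e IH] c //=; rewrite IH andbA. Qed.

Lemma cfg_rcons e p k : cfg (rcons e (p, k)) = (step (cfg e) p k).1.
Proof. by rewrite /Defs.cfg -cats1 run_from_cat. Qed.

Lemma elog_rcons e p k : elog (rcons e (p, k)) =
  rcons (elog e) (p, k, kind_of (next (cfg e) p), (step (cfg e) p k).2).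
Proof. by rewrite /Defs.elog -cats1 run_from_cat /= cats1. Qed.

Lemma valid_rcons e p k : valid (rcons e (p, k)) =
  valid e && (match next (cfg e) p with NFlip d => (0 < d k)%R | _ => k == 0 end).
Proof. by rewrite /Defs.valid -cats1 valid_from_cat /= andbT. Qed.

Lemma hist_rcons e p k : hist I M (rcons e (p, k)) =
  hist I M e ++ seq_of_opt (step (cfg e) p k).2.
Proof.
by rewrite /hist elog_rcons -cats1 pmap_cat.
Qed.

Lemma Tsteps_rcons e p k q : Tsteps I M (rcons e (p, k)) q =
  Tsteps I M e q + ((p == q) && is_shmI (kind_of (next (cfg e) p))).
Proof. by rewrite /Tsteps elog_rcons -cats1 count_cat /= addn0. Qed.

Definition all_coins e p : seq nat :=
  [seq x.1.1.2 | x <- elog e & (x.1.1.1 == p) && is_flip x.1.2].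

Lemma all_coins_rcons e p k q : all_coins (rcons e (p, k)) q =
  if (p == q) && is_flip (kind_of (next (cfg e) p)) then rcons (all_coins e q) k
  else all_coins e q.
Proof.
by rewrite /all_coins elog_rcons filter_rcons /=; case: ifP; rewrite ?map_rcons.
Qed.

(** A shared-memory step of [q] reveals all its coins so far. This recursive form replaces the
    search in the reversed log. *)
Lemma vis_coins_rcons e p k q : vis_coins I M (rcons e (p, k)) q =
  if (p == q) && is_shm (kind_of (next (cfg e) p)) then all_coins e q
  else vis_coins I M e q.
Proof.
rewrite /vis_coins /all_coins elog_rcons rev_rcons size_rcons /=.
case: ifP => _; first by rewrite subn1 /= -cats1 take_size_cat.
rewrite subSS -cats1 takel_cat //; exact: leq_subr.
Qed.

End Executions.

(** * The truncated geometric distribution *)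

Section Coin.
Variable B : nat.
Hypothesis B_gt1 : 1 < B.
Local Open Scope ring_scope.

(** The geometric tail is collected at [B.-1]. The value 0 has probability 1/2, so the same
    distribution also supplies the fair coin of the races. *)
Definition coinw (k : nat) : Rl :=
  if (k < B.-1)%N then 2^-1 ^+ k.+1 else if k == B.-1 then 2^-1 ^+ B.-1 else 0.

Lemma coinw_ge0 k : 0 <= coinw k.
Proof. by rewrite /coinw; do 2?case: ifP => // _; rewrite exprn_ge0 ?invr_ge0 ?ler0n. Qed.

Lemma coinw_lt k : 0 < coinw k -> (k < B)%N.
Proof.
rewrite /coinw; case: ltnP => h; first by move=> _; lia.
by case: eqP => [->|_]; [move=> _; lia|rewrite ltxx].
Qed.

Lemma coinw_tail t : (t <= B.-1)%N -> \sum_(t <= k < B) coinw k = 2^-1 ^+ t.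
Proof.
move=> tB; have [d dE] : exists d, (t + d = B.-1)%N by exists (B.-1 - t)%N; lia.
elim: d t tB dE => [|d IH] t tB dE.
  have eB : B = t.+1 by lia.
  by rewrite /coinw eB big_nat1 /= ltnn eqxx.
rewrite big_ltn; last by lia.
rewrite IH; [|lia|lia]; rewrite /coinw ifT; last by lia.
by rewrite exprS; lra.
Qed.

Lemma coinw_sum : \sum_(k < B) coinw k = 1.
Proof. by rewrite -(big_mkord xpredT) coinw_tail ?expr0. Qed.

Lemma coinw0 : coinw 0 = 2^-1.
Proof. by rewrite /coinw ifT ?expr1 //; lia. Qed.

(** An equality except at the truncation, where the last two weights coincide. *)
Lemma coinw_double k : (k.+1 < B)%N -> coinw k <= 2 * coinw k.+1.
Proof.
move=> kB; have h : 0 <= (2^-1 : Rl) ^+ k.+1 by rewrite exprn_ge0 ?invr_ge0 ?ler0n.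
rewrite /coinw; case: ltnP => h1; case: ltnP => h2; try lia.
  by rewrite [_ ^+ k.+2]exprS; lra.
have -> : B.-1 = k.+1 by lia.
by rewrite eqxx; lra.
Qed.

Lemma coin_avg_le (f : nat -> Rl) c : (forall x, (x < B)%N -> f x <= c) ->
  \sum_(x < B) coinw x * f x <= c.
Proof.
move=> hf; apply: (@le_trans _ _ (\sum_(x < B) coinw x * c)).
  by apply: ler_sum => x _; apply: ler_wpM2l; rewrite ?coinw_ge0 ?hf.
by rewrite -mulr_suml coinw_sum // mul1r.
Qed.

Lemma coin_avg2 (f : nat -> Rl) a b : f 0%N = a ->
  (forall x, (0 < x < B)%N -> f x = b) ->
  \sum_(x < B) coinw x * f x = (a + b) / 2.
Proof.
move=> fa fb; have := coinw_sum; have := coinw0.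
rewrite -!(big_mkord xpredT (fun x => coinw x * f x)) -(big_mkord xpredT coinw).
rewrite !(big_ltn (m := 0)) //; try lia.
move=> -> hs; rewrite fa (eq_big_nat _ _ (F2 := fun x => coinw x * b)); last first.
  by move=> x hx; rewrite fb //; lia.
by rewrite -mulr_suml; move: hs; nra.
Qed.

Lemma coin_series (f : nat -> \bar Rl) : (forall k, (0 <= f k)%E) ->
  (\sum_(0 <= k <oo) ((coinw k)%:E * f k) = \sum_(k < B) ((coinw k)%:E * f k))%E.
Proof.
move=> f0; rewrite (@nneseries_split _ _ 0 B); last first.
  by move=> k _; rewrite mule_ge0 // lee_fin coinw_ge0.
rewrite add0n eseries0 ?adde0 ?big_mkord // => i iB _.
suff -> : coinw i = 0 by rewrite mul0e.
by apply/eqP; rewrite eq_le coinw_ge0 andbT leNgt; apply/negP => /coinw_lt; lia.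
Qed.

Lemma coin_sum1 : (\sum_(0 <= k <oo) (coinw k)%:E = 1)%E.
Proof.
have := @coin_series (fun=> 1%E) (fun=> lee01).
under eq_eseriesr do rewrite mule1.
by under eq_bigr do rewrite mule1; move=> ->; rewrite sumEFin coinw_sum.
Qed.

Definition coin : dist := Dist coinw_ge0 coin_sum1.

End Coin.

(** * Registers, replay of local histories, and simulation by the automaton *)

Section Implementation.
Variable n : nat.

(** Makes [n < 2 ^ width.-1], so the last location is drawn with probability below 1/n. *)
Definition width : nat := (trunc_log 2 n).+2.

(** One location more than coin values, as the survival test reads the successor. The factor ['I_4]
    holds name, gate and the two race registers of a level. *)
Definition freg : finType := (bool + ('I_width * 'I_width.+1) + ('I_n.+1 * 'I_4))%type.

Definition encf (r : reg) : freg :=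
  match r with
  | RDoor => inl (inl false)
  | RDummy => inl (inl true)
  | RGrp i x => inl (inr (inord i, inord x))
  | RX i => inr (inord i, inord 0)
  | RY i => inr (inord i, inord 1)
  | RRace i a => inr (inord i, inord (2 + a))
  end.

(** Outside this range [inord] may merge registers; [action_range] shows that no step leaves it. *)
Definition in_range (r : reg) : bool :=
  match r with
  | RDoor | RDummy => true
  | RGrp i x => (i < width) && (x <= width)
  | RX i | RY i | RRace i _ => i <= n
  end.

Definition nregs : nat := #|freg|.
Definition enc (r : reg) : 'I_nregs := enum_rank (encf r).

Lemma inord_inj k i j : i <= k -> j <= k -> inord i = inord j :> 'I_k.+1 -> i = j.
Proof. by move=> hi hj /(congr1 val); rewrite /= !inordK. Qed.

Lemma enc_inj r r' : in_range r -> in_range r' -> enc r = enc r' -> r = r'.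
Proof.
move=> hr hr' /enum_rank_inj; case: r hr => [||i x|i|i|i a]; case: r' hr' => [||j y|j|j|j b] //=.
- move=> /andP[h1 h2] /andP[h3 h4] [] /(@inord_inj (trunc_log 2 n).+1 _ _ h3 h1) -> /(inord_inj h4 h2) -> //.
- by move=> h1 h2 [] /(inord_inj h2 h1) ->.
- by move=> h1 h2 [] _ /(congr1 val); rewrite /= !inordK.
- by move=> h1 h2 [] _ /(congr1 val); case: b; rewrite /= !inordK.
- by move=> h1 h2 [] _ /(congr1 val); rewrite /= !inordK.
- by move=> h1 h2 [] /(inord_inj h2 h1) ->.
- by move=> h1 h2 [] _ /(congr1 val); case: b; rewrite /= !inordK.
- by move=> h1 h2 [] _ /(congr1 val); case: a; rewrite /= !inordK.
- by move=> h1 h2 [] _ /(congr1 val); case: a; rewrite /= !inordK.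
- move=> h1 h2 [] /(inord_inj h2 h1) -> /(congr1 val).
  by case: a; case: b; rewrite /= !inordK.
Qed.

Lemma nregsE : nregs = 2 + width * width.+1 + n.+1 * 4.
Proof. by rewrite /nregs /freg !card_sum !card_prod card_bool !card_ord. Qed.

(** The model appends two entries per shared-memory step, the coin and the value read (0 for a
    write), hence the replay in pairs. *)
Fixpoint runl (p : 'I_n) (l : lst) (h : seq nat) : lst :=
  if h is x :: v :: h' then runl p (delta width p l x v) h' else l.

Definition enc_op (a : act) : op 'I_nregs :=
  match a with ARead r => Defs.ORead (enc r) | AWrite r v => Defs.OWrite (enc r) v end.

Lemma width_gt1 : 1 < width. Proof. by []. Qed.

Definition tas : impl n nregs := Impl (fun=> 0) (fun p h =>
  let l := runl p lst0 h in
  if ph l is PRet b then IReturn _ b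
  else IStep (coin width_gt1) (fun x => enc_op (action p l x))).

Lemma runl_rcons2 p l h x v : ~~ odd (size h) ->
  runl p l (h ++ [:: x; v]) = delta width p (runl p l h) x v.
Proof.
have [k] := ubnP (size h); elim: k h l => // k IH [|y [|z h]] l //= hk ev.
by rewrite IH //; [lia|rewrite -(negbK (odd _))].
Qed.

Section Simulation.
Variable M : malg n.
Implicit Types (e : exec n) (p q : 'I_n) (s : st n).
Local Notation cfg := (Defs.cfg tas M).
Local Notation valid := (Defs.valid tas M).
Local Notation next := (Defs.next tas M).
Local Notation step := (Defs.step tas M).

(** A pending coin has no counterpart in the automaton and is only required to be below [width].
    After the return the model drops the local history, while the automaton keeps its final
    state. *)
Definition sim_lst (ol : option lst) p (ls : lstate) : Prop :=
  if ol is Some l then invd ls /\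
    (if ih ls is Some h then
       [/\ ~~ odd (size h), l = runl p lst0 h & forall x, pf ls = Some x -> x < width]
     else exists b, ph l = PRet b)
  else invd ls = false /\ ih ls = None.

Record sim e s : Prop := Sim {
  sim_loc : forall p, sim_lst (lo s p) p (loc (cfg e) p);
  sim_mem : forall r, in_range r -> imem (cfg e) (enc r) = me s r;
  sim_steps : forall p, Tsteps tas M e p = if lo s p is Some l then cn l else 0 }.

Definition act_reg (a : act) : reg := match a with ARead r | AWrite r _ => r end.

Lemma action_range s p l x : reach width s -> lo s p = Some l -> active l -> x < width ->
  in_range (act_reg (action p l x)).
Proof.
move=> rs h al xw; have := tp_le_n rs h; have := reach_wf rs h.
move: al; rewrite /wf /action /active; case: (ph l) => [||||||||||b] //= _ wl tn; try lia.
by case: ifP => //=; lia.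
Qed.

Variant sim_step e s p : nact nregs -> st n -> option (event n) -> Prop :=
| SimFlip (d : dist) : sim_step e s p (NFlip _ d) s None
| SimShmM (o : op nat) : sim_step e s p (NShmM _ o) s None
| SimDone : sim_step e s p (NDone _) s None
| SimInvoke of lo s p = None : sim_step e s p (NInvoke _) (ainv p s) (Some (Defs.Inv p))
| SimReturn b l of lo s p = Some l & ph l = PRet b :
    sim_step e s p (NReturn _ b) s (Some (Resp p b))
| SimShm l x of lo s p = Some l & active l & (x < width)%N
    & pf (loc (cfg e) p) = Some x :
    sim_step e s p (NShmI (enc_op (action p l x))) (astep width p x s) None.

Lemma simP e s p k : reach width s -> sim e s -> valid (rcons e (p, k)) ->
  exists s', sim (rcons e (p, k)) s' /\
    sim_step e s p (next (cfg e) p) s' (step (cfg e) p k).2.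
Proof.
move=> rs sm; rewrite valid_rcons => /andP[ve vk].
have hl := sim_loc sm p; have := cfg_rcons tas M e p k.
have hT q : Tsteps tas M (rcons e (p, k)) q =
    Tsteps tas M e q + ((p == q) && is_shmI (kind_of (next (cfg e) p))).
  exact: Tsteps_rcons.
have keep s' ls' : (forall q, q <> p -> lo s' q = lo s q) ->
  sim_lst (lo s' p) p ls' ->
  (forall q, sim_lst (lo s' q) q (if q == p then ls' else loc (cfg e) q)).
  move=> h1 h2 q; case: eqP => [->//|ne]; rewrite h1 //; exact: sim_loc sm q.
move: vk hT; rewrite /Defs.next /Defs.step /Defs.next.
case hih: (ih (loc (cfg e) p)) => [h|].
{ move: hl; rewrite /sim_lst hih; case hlo: (lo s p) => [l|]; last by case.
  case=> inv [ev lE pfE].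
  have [[b phb]|[al iE]] : (exists b, ph l = PRet b) \/
      active l /\ iprog tas p h = IStep (coin width_gt1) (fun x => enc_op (action p l x)).
    rewrite /active /= -lE; case: (ph l); try by right.
    by left; eexists.
  { have -> : iprog tas p h = IReturn _ b by rewrite /= -lE phb.
    move=> /= _ hT cE; exists s; split; last exact: SimReturn hlo phb.
    split; rewrite ?cE; [|exact: sim_mem sm|].
      by apply: (keep s (LS _ _ _ _)) => //; rewrite hlo; split=> //; exists b.
    by move=> q; rewrite hT andbF addn0; apply: sim_steps sm q. }
  rewrite iE; case hpf: (pf (loc (cfg e) p)) => [x|] /=; last first.
    move=> /coinw_lt kw hT cE; exists s; split; last exact: SimFlip.
    split; rewrite ?cE; [|exact: sim_mem sm|].
      apply: (keep s (LS _ _ _ _)) => //; rewrite hlo; split=> //; split=> // y [<-].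
      exact: kw.
    by move=> q; rewrite hT andbF addn0; apply: sim_steps sm q.
  move=> _ hT cE; have xw := pfE _ hpf.
  exists (astep width p x s); have -> :
    match enc_op (action p l x) with
    | ORead r => (upd_loc (cfg e) p (LS (mh (loc (cfg e) p)) (invd (loc (cfg e) p))
         (Some (h ++ [:: x; imem (cfg e) r])) None), None)
    | OWrite r v => (upd_loc (Cfg (loc (cfg e)) (mmem (cfg e))
           (fun r' => if r' == r then v else imem (cfg e) r')) p
         (LS (mh (loc (cfg e) p)) (invd (loc (cfg e) p)) (Some (h ++ [:: x; 0])) None), None)
    end.2 = (None : option (event n)) by case: (enc_op _).
  split; last exact: SimShm.
  have rg := action_range rs hlo al xw; rewrite (astepE _ _ hlo).
  have dl v : sim_lst (Some (delta width p l x v)) p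
      (LS (mh (loc (cfg e) p)) (invd (loc (cfg e) p)) (Some (h ++ [:: x; v])) None).
    split=> //; split=> //; last by rewrite lE runl_rcons2.
    by rewrite size_cat oddD addbF.
  have ol q lq : q <> p -> lo (setl s p lq (memw (me s) (action p l x))) q = lo s q.
    exact: lo_setl_neq.
  split.
  - rewrite cE; move: dl rg; case: (action p l x) => [r|r v] /= dl rg.
      rewrite (sim_mem sm rg); apply: (keep (setl s p _ (me s)) (LS _ _ _ _)) => [q ne|]; first exact: lo_setl_neq.
      by rewrite lo_setl_eq; apply: dl.
    apply: (keep (setl s p _ (me s)) (LS _ _ _ _)) => [q ne|]; first exact: lo_setl_neq.
    by rewrite lo_setl_eq; apply: dl.
  - rewrite cE; move: rg; case: (action p l x) => [r|r v] /= rg r' hr'; first exact: (sim_mem sm hr').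
    rewrite (sim_mem sm hr'); case: (enc r' =P enc r) => [/(enc_inj hr' rg) ->|ne].
      by rewrite eqxx.
    by case: (r' =P r) => // e'; rewrite e' in ne.
  - move=> q; rewrite hT (sim_steps sm) andbT lo_setl eq_sym; case: eqP => [->|_]; last by rewrite addn0.
    rewrite hlo addn1; move: al; rewrite /active; case: l {lE hlo iE rg dl ol cE hT} => f t e0 g r st c k0 /=.
    by case: f => //= *; repeat case: ifP. }
move: hl; rewrite /sim_lst hih => hl.
have same c' : (forall q, loc c' q = if q == p then loc c' p else loc (cfg e) q) ->
    imem c' = imem (cfg e) -> cfg (rcons e (p, k)) = c' ->
    (forall q, Tsteps tas M (rcons e (p, k)) q = Tsteps tas M e q) ->
    invd (loc c' p) = invd (loc (cfg e) p) -> ih (loc c' p) = None ->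
    sim (rcons e (p, k)) s.
  move=> hc hm cE hT hi hh; split; rewrite ?cE ?hm; [|exact: sim_mem sm|].
    move=> q; rewrite hc; apply: (keep s) => //; rewrite /sim_lst hh hi.
    by case: (lo s p) hl.
  by move=> q; rewrite hT; apply: sim_steps sm q.
case hM: (M p (mh (loc (cfg e) p))) => [d f| |].
- case hpf: (pf (loc (cfg e) p)) => [x|].
    case: (f x) => [r|r v] /= _ hT cE; exists s; split; try exact: SimShmM.
      by apply: (same _ _ _ cE) => //= *; rewrite ?eqxx ?hT ?andbF ?addn0.
    by apply: (same _ _ _ cE) => //= *; rewrite ?eqxx ?hT ?andbF ?addn0.
  move=> /= _ hT cE; exists s; split; last exact: SimFlip.
  by apply: (same _ _ _ cE) => //= *; rewrite ?eqxx ?hT ?andbF ?addn0.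
- case hi: (invd (loc (cfg e) p)) => /= _ hT cE.
    exists s; split; last exact: SimDone.
    apply: (same _ _ _ cE) => // [q|q]; first by case: eqP => // ->.
    by rewrite hT andbF addn0.
  have lo0 : lo s p = None by move: hl; case: (lo s p) => // l []; rewrite hi.
  exists (ainv p s); split; last exact: SimInvoke.
  split; rewrite ?cE; [|exact: sim_mem sm|].
    by apply: (keep (ainv p s) (LS _ _ _ _)) => [q ne|]; [exact: lo_setl_neq|rewrite lo_setl_eq].
  move=> q; rewrite hT andbF addn0 (sim_steps sm) lo_setl; case: eqP => [->|//].
  by rewrite lo0.
- move=> /= _ hT cE; exists s; split; last exact: SimDone.
  apply: (same _ _ _ cE) => // [q|q]; first by case: eqP => // ->.
  by rewrite hT andbF addn0.
Qed.

End Simulation.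
End Implementation.

(** * Deferred coins *)

Section Resampling.
Variables (n B : nat).
Hypothesis B_gt1 : 1 < B.
Local Notation hid := {ffun 'I_n -> 'I_B}.
Local Open Scope ring_scope.

Definition setc (f : hid) (p : 'I_n) (j : 'I_B) : hid :=
  [ffun q => if q == p then j else f q].

Definition hprob (f : hid) : Rl := \prod_p coinw B (f p).

Lemma hprob_ge0 f : 0 <= hprob f.
Proof. by apply: prodr_ge0 => p _; apply: coinw_ge0. Qed.

Lemma setc_id f p : setc f p (f p) = f.
Proof. by apply/ffunP => q; rewrite ffunE; case: eqP => [->|]. Qed.

Lemma setc_setc f p i j : setc (setc f p i) p j = setc f p j.
Proof. by apply/ffunP => q; rewrite !ffunE; case: eqP. Qed.

Lemma setc_eq f p (j : 'I_B) : setc f p j p = j.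
Proof. by rewrite ffunE eqxx. Qed.

Lemma hprob_setc f p (j : 'I_B) : coinw B j * hprob f = coinw B (f p) * hprob (setc f p j).
Proof.
rewrite /hprob (bigD1 p) //= [X in _ = _ * X](bigD1 p) //= setc_eq mulrCA.
congr (_ * (_ * _)); apply: eq_bigr => q ne; by rewrite ffunE (negbTE ne).
Qed.

Lemma hprob_sum : \sum_f hprob f = 1.
Proof.
rewrite /hprob -(bigA_distr_bigA (fun (p : 'I_n) (j : 'I_B) => coinw B j)).
by apply: big1 => p _; rewrite coinw_sum.
Qed.

Local Open Scope ereal_scope.

(** Exchanging the fresh coin [j] with [f p] is an involution on pairs that preserves the product
    measure. *)
Lemma resample (G : hid -> \bar Rl) p : (forall f, 0 <= G f) ->
  \sum_f (hprob f)%:E * G f =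
  \sum_(j < B) (coinw B j)%:E * \sum_f (hprob f)%:E * G (setc f p j).
Proof.
move=> G0; transitivity (\sum_(j < B) \sum_(f : hid)
    ((coinw B (f p) * hprob (setc f p j))%:E * G (setc f p j))); last first.
  apply: eq_bigr => j _; rewrite ge0_sume_distrr.
    by apply: eq_bigr => f _; rewrite muleA -EFinM (hprob_setc f p j).
  by move=> f _; rewrite mule_ge0 // lee_fin hprob_ge0.
rewrite pair_big /=.
pose h (x : 'I_B * hid) := (x.2 p, setc x.2 p x.1).
have hK : involutive h.
  by case=> j f; rewrite /h /= setc_eq setc_setc setc_id.
rewrite [RHS](reindex_inj (inv_inj hK)) /=.
rewrite -(pair_big xpredT xpredT (fun j f => (coinw B (setc f p j p) * hprob (setc (setc f p j) p (f p)))%:E *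
  G (setc (setc f p j) p (f p)))) /=.
rewrite exchange_big /=; apply: eq_bigr => f _.
under eq_bigr do rewrite setc_eq setc_setc setc_id EFinM -muleA.
rewrite -ge0_sume_distrl; last by move=> i _; rewrite lee_fin coinw_ge0.
by rewrite sumEFin coinw_sum // mul1e.
Qed.

End Resampling.

(** * Executions indistinguishable for a location-oblivious adversary *)

Section Twins.
Variables (n m : nat) (I : impl n m) (M : malg n).
Implicit Types (e : exec n) (p q : 'I_n) (H : {set 'I_n}).
Local Notation cfg := (Defs.cfg I M).
Local Notation next := (Defs.next I M).
Local Notation step := (Defs.step I M).
Local Notation all_coins := (all_coins I M).
Local Notation vis_coins := (Defs.vis_coins I M).

(* Executions that differ only in the pending coins of the processes in [H]; a
   location-oblivious adversary cannot tell them apart. *)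
Record twin H e1 e2 : Prop := Twin {
  t_sched : map fst e1 = map fst e2;
  t_mmem : mmem (cfg e1) = mmem (cfg e2);
  t_imem : imem (cfg e1) = imem (cfg e2);
  t_loc : forall p, p \notin H -> loc (cfg e1) p = loc (cfg e2) p;
  t_coins : forall p, p \notin H -> all_coins e1 p = all_coins e2 p;
  t_vis : forall p, vis_coins e1 p = vis_coins e2 p;
  t_hid : forall p, p \in H -> exists l,
    [/\ mh (loc (cfg e1) p) = mh (loc (cfg e2) p),
        invd (loc (cfg e1) p) = invd (loc (cfg e2) p),
        ih (loc (cfg e1) p) = ih (loc (cfg e2) p),
        all_coins e1 p = rcons l (odflt 0 (pf (loc (cfg e1) p))) &
        all_coins e2 p = rcons l (odflt 0 (pf (loc (cfg e2) p)))] }.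

Lemma twin_next H e1 e2 p : twin H e1 e2 -> p \notin H ->
  next (cfg e1) p = next (cfg e2) p.
Proof. by move=> tw pH; rewrite /Defs.next (t_loc tw pH). Qed.

Lemma step_other c p k q : q != p -> loc (step c p k).1 q = loc c q.
Proof.
move=> /negbTE ne; rewrite /Defs.step; case: (next c p) => [d|[r|r v]|[r|r v]| |b|] //=;
  by rewrite ne.
Qed.

Lemma twin_step H e1 e2 p k : twin H e1 e2 -> p \notin H ->
  [/\ mmem (step (cfg e1) p k).1 = mmem (step (cfg e2) p k).1,
      imem (step (cfg e1) p k).1 = imem (step (cfg e2) p k).1 &
      loc (step (cfg e1) p k).1 p = loc (step (cfg e2) p k).1 p].
Proof.
move=> tw pH; rewrite /Defs.step (twin_next tw pH) (t_loc tw pH) (t_mmem tw) (t_imem tw).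
by case: (next _ p) => [d|[r|r v]|[r|r v]| |b|] /=; rewrite ?eqxx ?(t_mmem tw) ?(t_imem tw) ?(t_loc tw pH).
Qed.

Lemma twin_rcons H e1 e2 p k : twin H e1 e2 -> p \notin H ->
  twin H (rcons e1 (p, k)) (rcons e2 (p, k)).
Proof.
move=> tw pH; have [hm hi hl] := twin_step k tw pH.
have nx := twin_next tw pH.
split; rewrite ?cfg_rcons //.
- by rewrite !map_rcons (t_sched tw).
- move=> q qH; have [->//|ne] := eqVneq q p; by rewrite !step_other // (t_loc tw).
- by move=> q qH; rewrite !all_coins_rcons nx (t_coins tw qH).
- move=> q; rewrite !vis_coins_rcons nx; have [pq|_] := eqVneq p q; last exact: (t_vis tw).
  by subst q; rewrite (t_coins tw pH) (t_vis tw).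
- move=> q qH; have ne : q != p by apply: contraTneq qH => ->.
  have [l hq] := t_hid tw qH; exists l.
  by rewrite !step_other // !all_coins_rcons eq_sym (negbTE ne).
Qed.

(** The two outcomes may differ: an unrevealed coin changes nothing visible, and [p] merely joins
    the hidden set. *)
Lemma twin_flip H e1 e2 p k1 k2 d : twin H e1 e2 -> p \notin H ->
  next (cfg e1) p = NFlip _ d ->
  twin (p |: H) (rcons e1 (p, k1)) (rcons e2 (p, k2)).
Proof.
move=> tw pH n1; have n2 := n1; rewrite (twin_next tw pH) in n2.
split; rewrite ?cfg_rcons /Defs.step ?n1 ?n2 /=.
- by rewrite !map_rcons (t_sched tw).
- exact: (t_mmem tw).
- exact: (t_imem tw).
- by move=> q; rewrite !inE negb_or => /andP[/negbTE-> qH]; exact: (t_loc tw qH).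
- move=> q; rewrite !inE negb_or => /andP[/negbTE ne qH].
  by rewrite !all_coins_rcons eq_sym ne (t_coins tw qH).
- by move=> q; rewrite !vis_coins_rcons n1 n2 /= !andbF (t_vis tw).
- move=> q; rewrite !inE => qH; rewrite !all_coins_rcons n1 n2 /= !andbT (eq_sym p q).
  have [->|ne] /= := eqVneq q p.
    by exists (all_coins e1 p); rewrite (t_loc tw pH) (t_coins tw pH).
  by move: qH; rewrite (negbTE ne) => /(t_hid tw).
Qed.

(** To be applied just before the shared-memory step of [p], which makes its coin visible. *)
Lemma twin_reveal H e1 e2 p : twin H e1 e2 ->
  pf (loc (cfg e1) p) = pf (loc (cfg e2) p) -> twin (H :\ p) e1 e2.
Proof.
move=> tw pE; split; try by case: tw.
- move=> q; rewrite !inE negb_and negbK => /orP[/eqP->|]; last exact: (t_loc tw).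
  case: (boolP (p \in H)) => [/(t_hid tw)[l []]|]; last exact: (t_loc tw).
  by move: pE; case: (loc (cfg e1) p) => /= ? ? ? ?; case: (loc (cfg e2) p) => /= ? ? ? ? -> -> -> ->.
- move=> q; rewrite !inE negb_and negbK => /orP[/eqP->|]; last exact: (t_coins tw).
  case: (boolP (p \in H)) => [/(t_hid tw)[l []]|]; last exact: (t_coins tw).
  by rewrite pE => _ _ _ -> ->.
- by move=> q; rewrite !inE => /andP[_ /(t_hid tw)].
Qed.

Lemma expN_ge0 (A : adversary n) N e : (0 <= expN I M A N e)%E.
Proof.
elim: N e => [|N IH] e /=; first by rewrite lee_fin ler0n.
case: (next _ _) => *; try exact: IH.
by apply: nneseries_ge0 => k _ _; rewrite mule_ge0 // lee_fin dm_ge0.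
Qed.

End Twins.

(** * A supermartingale of the automaton bounds the expected maximum *)

Section Deferral.
Variables (n : nat) (M : malg n) (A : adversary n) (e0 : exec n) (K : nat).
Implicit Types (e : exec n) (p q : 'I_n) (H : {set 'I_n}) (s : st n).
Local Notation I := (tas n).
Local Notation B := (width n).
Local Notation hid := {ffun 'I_n -> 'I_B}.
Local Notation cfg := (Defs.cfg I M).
Local Notation valid := (Defs.valid I M).
Local Notation next := (Defs.next I M).
Implicit Types f g : hid.

Definition invoked s : nat := #|[pred p | isSome (lo s p)]|.

Hypothesis A_obl : oblivious I M A.
Hypothesis cont : contention_le I M e0 K.

Variable Psi : st n -> Rl.
Hypothesis Psi_ge : forall s p l, reach B s -> lo s p = Some l -> ((cn l)%:R <= Psi s)%R.
Hypothesis Psi_ge0 : forall s, reach B s -> (0 <= Psi s)%R.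
Hypothesis Psi_inv : forall s p, reach B s -> lo s p = None ->
  invoked (ainv p s) <= K -> (Psi (ainv p s) <= Psi s)%R.
Hypothesis Psi_step : forall s p l, reach B s -> lo s p = Some l -> active l ->
  (\sum_(x < B) coinw B x * Psi (astep B p x s) <= Psi s)%R.

Lemma sim_next_shm e s p l x : sim M e s -> lo s p = Some l -> active l ->
  pf (loc (cfg e) p) = Some x -> next (cfg e) p = NShmI (enc_op n (action p l x)).
Proof.
move=> sm hlo al hpf; have := sim_loc sm p; rewrite /sim_lst hlo => -[_].
rewrite /Defs.next; case: (ih _) => [h|]; last by case=> b eb; move: al; rewrite /active eb.
by case=> _ lE _; rewrite /= -lE hpf; move: al; rewrite /active; case: (ph l).
Qed.

Lemma sim_shm e s p l x : reach B s -> sim M e s -> valid e -> lo s p = Some l ->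
  active l -> pf (loc (cfg e) p) = Some x ->
  [/\ x < B, valid (rcons e (p, 0)) & sim M (rcons e (p, 0)) (astep B p x s)].
Proof.
move=> rs sm ve hlo al hpf; have nx := sim_next_shm sm hlo al hpf.
have vr : valid (rcons e (p, 0)) by rewrite valid_rcons nx ve.
have [s' [sm' st]] := simP rs sm vr; rewrite nx in st.
inversion st as [| | | | |l' x' hlo' al' xB hpf']; subst.
rewrite hpf in hpf'; case: hpf' => ?; subst x'.
by rewrite hlo in hlo'; case: hlo' => ?; subst l'.
Qed.

Lemma sim_invoke e s p : reach B s -> sim M e s -> valid e ->
  next (cfg e) p = NInvoke _ ->
  [/\ lo s p = None, valid (rcons e (p, 0)) & sim M (rcons e (p, 0)) (ainv p s)].
Proof.
move=> rs sm ve nx; have vr : valid (rcons e (p, 0)) by rewrite valid_rcons nx ve.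
have [s' [sm' st]] := simP rs sm vr; rewrite nx in st.
by inversion st; subst.
Qed.

Lemma sim_same e s p k : reach B s -> sim M e s -> valid (rcons e (p, k)) ->
  (if next (cfg e) p is (NInvoke | NShmI _) then false else true) ->
  sim M (rcons e (p, k)) s.
Proof.
move=> rs sm vr; have [s' [sm' st]] := simP rs sm vr.
by move: sm'; case: st.
Qed.

(* [F f] is one and the same visible execution, with the hidden coin of each
   process [p] of [H] set to [f p]. *)
Record family H (F : hid -> exec n) s : Prop := Family {
  f_reach : reach B s;
  f_sim : forall f, sim M (F f) s;
  f_valid : forall f, valid (F f);
  f_pre : forall f, exists t, F f = e0 ++ t;
  f_hid : forall f p, p \in H -> pf (loc (cfg (F f)) p) = Some (f p : nat) /\
    exists2 l, lo s p = Some l & active l;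
  f_nohid : forall f p, p \notin H -> isSome (ih (loc (cfg (F f)) p)) ->
    pf (loc (cfg (F f)) p) = None;
  f_twin : forall f g, twin I M H (F f) (F g);
  f_dep : forall f g, (forall p, p \in H -> f p = g p) -> F f = F g }.

(** In [action] the coin selects the register only, so kind and value of every pending step agree
    over the family, and the hidden coins are not yet visible. *)
Lemma family_adv H F s f g : family H F s -> A (F f) = A (F g).
Proof.
move=> fa; have tw := f_twin fa f g; apply: A_obl; try exact: (f_valid fa).
- exact: (t_sched tw).
- exact: (t_vis tw).
- move=> p; rewrite /pending; case: (boolP (p \in H)) => pH; last by rewrite (twin_next tw pH).
  have [pff [l hlo al]] := f_hid fa f pH; have [pfg _] := f_hid fa g pH.
  rewrite (sim_next_shm (f_sim fa f) hlo al pff) (sim_next_shm (f_sim fa g) hlo al pfg).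
  by rewrite /action; case: (ph l).
Qed.

Lemma maxT_sim e s : reach B s -> sim M e s -> ((maxT I M e)%:R <= Psi s)%R.
Proof.
move=> rs sm; rewrite /maxT.
apply: (@big_ind nat (fun k => (k%:R <= Psi s)%R)); first exact: Psi_ge0.
  by move=> a b ha hb; rewrite /maxn; case: ifP.
move=> p _; rewrite (sim_steps sm); case h: (lo s p) => [l|]; last exact: Psi_ge0.
exact: Psi_ge h.
Qed.

Lemma sim_invoked e s : sim M e s -> invoked s = #|[pred p | invd (loc (cfg e) p)]|.
Proof.
move=> sm; apply: eq_card => p; rewrite !inE; have := sim_loc sm p.
by rewrite /sim_lst; case: (lo s p) => [l [-> _]|[-> _]].
Qed.

Lemma family_next H F s p k s' : family H F s -> p \notin H -> reach B s' ->
  (forall f, valid (rcons (F f) (p, k)) /\ sim M (rcons (F f) (p, k)) s') ->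
  (forall f, isSome (ih (loc (cfg (rcons (F f) (p, k))) p)) ->
     pf (loc (cfg (rcons (F f) (p, k))) p) = None) ->
  (forall q, q != p -> lo s' q = lo s q) ->
  family H (fun f => rcons (F f) (p, k)) s'.
Proof.
move=> fa pH rs' hs hp hq; split=> //.
- by move=> f; case: (hs f).
- by move=> f; case: (hs f).
- by move=> f; have [t ->] := f_pre fa f; exists (rcons t (p, k)); rewrite rcons_cat.
- move=> f q qH; have ne : q != p by apply: contraTneq qH => ->.
  by rewrite cfg_rcons step_other // hq //; apply: (f_hid fa).
- move=> f q qH; have [->|ne] := eqVneq q p; first exact: hp.
  by rewrite cfg_rcons step_other //; apply: (f_nohid fa).
- by move=> f g; apply: twin_rcons => //; apply: (f_twin fa).
- by move=> f g /(f_dep fa) ->.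
Qed.

Lemma family_shm H F s p l (j : 'I_B) : family H F s -> p \in H ->
  lo s p = Some l -> active l ->
  family (H :\ p) (fun f => rcons (F (setc f p j)) (p, 0)) (astep B p j s).
Proof.
move=> fa pH hlo al.
have pfj f : pf (loc (cfg (F (setc f p j))) p) = Some (j : nat).
  by have [-> _] := f_hid fa (setc f p j) pH; rewrite setc_eq.
have hs f := sim_shm (f_reach fa) (f_sim fa (setc f p j)) (f_valid fa _) hlo al (pfj f).
have nx f := sim_next_shm (f_sim fa (setc f p j)) hlo al (pfj f).
split.
- exact: reachS (f_reach fa) hlo al (ltn_ord j).
- by move=> f; case: (hs f).
- by move=> f; case: (hs f).
- by move=> f; have [t ->] := f_pre fa (setc f p j); exists (rcons t (p, 0)); rewrite rcons_cat.
- move=> f q; rewrite !inE => /andP[ne qH]; rewrite cfg_rcons step_other //.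
  have [-> hl] := f_hid fa (setc f p j) qH; rewrite ffunE (negbTE ne); split=> //.
  by case: hl => l' hl' al'; exists l' => //; rewrite (astepE _ _ hlo) lo_setl_neq //; apply/eqP.
- move=> f q; rewrite !inE negb_and negbK cfg_rcons.
  have [-> _ _|ne /= qH] := eqVneq q p; last by rewrite step_other //; apply: (f_nohid fa).
  by rewrite /Defs.step nx; case: (enc_op _ _) => [r|r v] /=; rewrite eqxx.
- move=> f g; apply: twin_rcons; last by rewrite !inE eqxx.
  by apply: twin_reveal; rewrite ?pfj //; apply: (f_twin fa).
- move=> f g hfg; congr (rcons _ _); apply: (f_dep fa) => q qH; rewrite !ffunE.
  by case: eqP => // /eqP ne; apply: hfg; rewrite !inE ne.
Qed.

Lemma family_flip H F s p d : family H F s -> p \notin H ->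
  (forall f, next (cfg (F f)) p = NFlip _ d) ->
  (forall f, isSome (ih (loc (cfg (F f)) p))) ->
  d = coin (width_gt1 n) /\ family (p |: H) (fun f => rcons (F f) (p, f p : nat)) s.
Proof.
move=> fa pH nx hih.
have hfl f : d = coin (width_gt1 n) /\ exists2 l, lo s p = Some l & active l.
  have := sim_loc (f_sim fa f) p; have := hih f; have := nx f; rewrite /Defs.next /sim_lst.
  case: (ih _) => [h|//]; case: (lo s p) => [l|]; last by move=> _ _ [].
  rewrite /= => + _ [_ [_ lE _]]; rewrite -lE /active.
  case E: (ph l) => //=; rewrite ?E; case: (pf _) => // -[<-] //; split=> //;
    by exists l; rewrite ?E.
have [dE _] := hfl [ffun=> ord0]; split=> //.
have vr f : valid (rcons (F f) (p, f p : nat)).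
  rewrite valid_rcons (f_valid fa) nx dE /= /coinw.
  case: ltnP => h1; first by rewrite exprn_gt0 // invr_gt0.
  by rewrite ifT ?exprn_gt0 ?invr_gt0 //; have := ltn_ord (f p); lia.
split=> //.
- exact: (f_reach fa).
- by move=> f; apply: sim_same (f_reach fa) (f_sim fa f) (vr f) _; rewrite nx.
- by move=> f; have [t ->] := f_pre fa f; exists (rcons t (p, f p : nat)); rewrite rcons_cat.
- move=> f q; rewrite !inE cfg_rcons; have [-> _|ne /= qH] := eqVneq q p.
    by split; [rewrite /Defs.step nx /= eqxx|have [] := hfl f].
  by rewrite step_other //; apply: (f_hid fa).
- move=> f q; rewrite !inE negb_or => /andP[ne qH].
  by rewrite cfg_rcons step_other //; apply: (f_nohid fa).
- by move=> f g; apply: twin_flip (nx f) => //; apply: (f_twin fa).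
- move=> f g hfg; rewrite (hfg p) ?inE ?eqxx //; congr (rcons _ _); apply: (f_dep fa) => q qH.
  by apply: hfg; rewrite !inE qH orbT.
Qed.

Lemma hid_avg_le (G : hid -> \bar Rl) (c : Rl) : (forall f, (G f <= c%:E)%E) ->
  (\sum_f (hprob f)%:E * G f <= c%:E)%E.
Proof.
move=> hG; apply: (@le_trans _ _ (\sum_f (hprob f)%:E * c%:E)%E).
  by apply: lee_sum => f _; apply: lee_wpmul2l; rewrite ?lee_fin ?hprob_ge0.
under eq_bigr do rewrite -EFinM.
by rewrite sumEFin -mulr_suml hprob_sum // mul1r.
Qed.

Local Notation expN := (expN I M A).

Lemma expN_keep e N : (forall d, next (cfg e) (A e) <> NFlip _ d) ->
  expN N.+1 e = expN N (rcons e (A e, 0)).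
Proof. by move=> h /=; case E: (Defs.next _ _ _ _) => //; case: (h _ E). Qed.

Lemma expN_flip e N d : next (cfg e) (A e) = NFlip _ d ->
  expN N.+1 e = (\sum_(0 <= k <oo) ((d k)%:E * expN N (rcons e (A e, k))))%E.
Proof. by move=> h /=; rewrite h. Qed.

Lemma dist_avg_le (d : dist) (G : nat -> \bar Rl) (c : Rl) : (0 <= c)%R ->
  (forall k, (0 <= G k)%E) -> (forall k, (0 < d k)%R -> (G k <= c%:E)%E) ->
  (\sum_(0 <= k <oo) ((d k)%:E * G k) <= c%:E)%E.
Proof.
move=> c0 G0 hG; apply: (@le_trans _ _ (\sum_(0 <= k <oo) (c%:E * (d k)%:E))%E).
  apply: lee_nneseries => [k _ _|k _]; first by rewrite mule_ge0 // lee_fin dm_ge0.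
  rewrite [leRHS]muleC; have := dm_ge0 d k; rewrite le_eqVlt => /orP[/eqP<-|dk].
    by rewrite !mul0e.
  by apply: lee_wpmul2l; rewrite ?lee_fin ?dm_ge0 ?hG.
rewrite nneseriesZl; last by move=> k _; rewrite lee_fin dm_ge0.
by rewrite dm_sum mule1.
Qed.

(** All members share one automaton state. A hidden coin is resampled when its shared-memory step is
    due: the adversary has then chosen [p] for all members alike, so the coin is independent of that
    choice and [Psi_step] applies. *)
Theorem family_bound N H F s : family H F s ->
  (\sum_f (hprob f)%:E * expN N (F f) <= (Psi s)%:E)%E.
Proof.
elim: N H F s => [|N IH] H F s fa.
  by apply: hid_avg_le => f /=; rewrite lee_fin; apply: maxT_sim (f_reach fa) (f_sim fa f).
pose f0 : hid := [ffun=> ord0]; pose p := A (F f0).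
have eA f : A (F f) = p by apply: family_adv fa.
have [pH|pH] := boolP (p \in H).
  have [_ [l hlo al]] := f_hid fa f0 pH.
  under eq_bigr => f _.
    rewrite expN_keep; last first.
      move=> d; rewrite eA; have [pff _] := f_hid fa f pH.
      by rewrite (sim_next_shm (f_sim fa f) hlo al pff).
    rewrite eA; over.
  rewrite (@resample n B _ _ p) //; last by move=> f; apply: expN_ge0.
  apply: (@le_trans _ _ (\sum_(j < B) (coinw B j)%:E * (Psi (astep B p j s))%:E)%E).
    apply: lee_sum => j _; apply: lee_wpmul2l; first by rewrite lee_fin coinw_ge0.
    exact: IH (family_shm j fa pH hlo al).
  under eq_bigr do rewrite -EFinM.
  by rewrite sumEFin lee_fin; apply: Psi_step hlo al; apply: (f_reach fa).
have nx f : next (cfg (F f)) p = next (cfg (F f0)) p by apply: twin_next (f_twin fa f f0) pH.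
have ihE f : ih (loc (cfg (F f)) p) = ih (loc (cfg (F f0)) p) by rewrite (t_loc (f_twin fa f f0) pH).
have keep s' : (forall d, next (cfg (F f0)) p <> NFlip _ d) ->
    family H (fun f => rcons (F f) (p, 0)) s' -> (Psi s' <= Psi s)%R ->
    (\sum_f (hprob f)%:E * expN N.+1 (F f) <= (Psi s)%:E)%E.
  move=> nf fa' le; apply: (@le_trans _ _ (Psi s')%:E); last by rewrite lee_fin.
  apply: le_trans (IH _ _ _ fa'); rewrite le_eqVlt; apply/orP; left; apply/eqP.
  by apply: eq_bigr => f _; rewrite expN_keep eA // => d; rewrite nx; apply: nf.
have same k : (forall f, valid (rcons (F f) (p, k))) ->
    (if next (cfg (F f0)) p is (NInvoke | NShmI _) then false else true) ->
    (forall f, isSome (ih (loc (cfg (rcons (F f) (p, k))) p)) ->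
       pf (loc (cfg (rcons (F f) (p, k))) p) = None) ->
    family H (fun f => rcons (F f) (p, k)) s.
  move=> vr hn hp; apply: (family_next fa pH) => //; first exact: (f_reach fa).
  by move=> f; split=> //; apply: sim_same (f_reach fa) (f_sim fa f) (vr f) _; rewrite nx.
case nx0: (next (cfg (F f0)) p) => [d|o|o| |b|].
(* A flip inside the TAS call becomes coordinate [p] of [f], on which nothing depended so far by
   [f_dep], so it leaves the average unchanged. A flip of the calling algorithm is averaged at once,
   with the automaton at rest. *)
- case hih: (isSome (ih (loc (cfg (F f0)) p))).
    have [dE fa'] := family_flip fa pH (fun f => etrans (nx f) nx0)
      (fun f => etrans (congr1 isSome (ihE f)) hih).
    apply: le_trans (IH _ _ _ fa'); rewrite le_eqVlt; apply/orP; left; apply/eqP.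
    rewrite [RHS](@resample n B _ _ p) //; last by move=> f; apply: expN_ge0.
    transitivity (\sum_f \sum_(j < B) (hprob f)%:E *
        ((coinw B j)%:E * expN N (rcons (F f) (p, j : nat))))%E.
      apply: eq_bigr => f _; rewrite (expN_flip _ (d := d)) ?eA ?nx // dE.
      rewrite (@coin_series B _) //; last by move=> k; apply: expN_ge0.
      rewrite ge0_sume_distrr // => j _; rewrite mule_ge0 ?lee_fin ?coinw_ge0 //.
      exact: expN_ge0.
    rewrite exchange_big /=; apply: eq_bigr => j _.
    rewrite ge0_sume_distrr; last first.
      by move=> f _; rewrite mule_ge0 ?lee_fin ?hprob_ge0 //; apply: expN_ge0.
    apply: eq_bigr => f _; rewrite muleCA setc_eq; congr (_ * (_ * expN N (rcons _ _)))%E.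
    apply: (f_dep fa) => q qH; rewrite ffunE; case: eqP => // e.
    by rewrite e (negbTE pH) in qH.
  have ih0 f : ih (loc (cfg (F f)) p) = None by rewrite ihE; case: (ih _) hih.
  have step0 f k : ih (loc (cfg (rcons (F f) (p, k))) p) = None.
    by rewrite cfg_rcons /Defs.step nx nx0 /= eqxx ih0.
  under eq_bigr => f _.
    rewrite (expN_flip _ (d := d)) ?eA ?nx // -nneseriesZl; last first.
      by move=> k _; rewrite mule_ge0 ?lee_fin ?dm_ge0 //; apply: expN_ge0.
    over.
  rewrite -nneseries_sum; last first.
    move=> f k _; rewrite mule_ge0 ?lee_fin ?hprob_ge0 // mule_ge0 ?lee_fin ?dm_ge0 //.
    exact: expN_ge0.
  apply: le_trans (_ : (\sum_(0 <= k <oo) (d k)%:E *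
      \sum_f (hprob f)%:E * expN N (rcons (F f) (p, k)) <= _)%E).
    rewrite le_eqVlt; apply/orP; left; apply/eqP; apply: eq_eseriesr => k _.
    rewrite ge0_sume_distrr; last first.
      by move=> f _; rewrite mule_ge0 ?lee_fin ?hprob_ge0 //; apply: expN_ge0.
    by apply: eq_bigr => f _; rewrite muleCA.
  apply: dist_avg_le => [|k|k dk]; first exact: Psi_ge0 (f_reach fa).
    by apply: sume_ge0 => f _; rewrite mule_ge0 ?lee_fin ?hprob_ge0 //; apply: expN_ge0.
  apply: IH; apply: same; rewrite ?nx0 //; last by move=> f; rewrite step0.
  by move=> f; rewrite valid_rcons (f_valid fa) nx nx0.
- have ih0 f : ih (loc (cfg (F f)) p) = None.
    move: nx0; rewrite ihE /Defs.next; case: (ih _) => // h.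
    by case: (iprog _ _ _) => // d g; case: (pf _).
  apply: (keep s) => //; first by move=> d; rewrite nx0.
  apply: same; rewrite ?nx0 //.
    by move=> f; rewrite valid_rcons (f_valid fa) nx nx0.
  move=> f; rewrite cfg_rcons /Defs.step nx nx0; case: o {nx0} => [r|r v] /=;
    by rewrite eqxx /= ih0.
(* Impossible: a process inside its call with a pending coin belongs to [H]. *)
- move: nx0 (@f_nohid _ _ _ fa f0 p pH); rewrite /Defs.next; case: (ih _) => [h|].
    by case: (iprog _ _ _) => // d g; case: (pf _) => // x _ /(_ isT).
  by case: (M _ _) => [d g||] //; [case: (pf _)|case: (invd _)].
- have sv f := sim_invoke (f_reach fa) (f_sim fa f) (f_valid fa f) (etrans (nx f) nx0).
  have lo0 : lo s p = None by case: (sv f0).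
  have Kle : invoked (ainv p s) <= K.
    have [_ v0 sm0] := sv f0; rewrite (sim_invoked sm0).
    have [t tE] := f_pre fa f0; move: v0; rewrite tE rcons_cat; exact: cont.
  apply: (keep (ainv p s)); first by move=> d; rewrite nx0.
  { apply: (family_next fa pH).
    + exact: reachI (f_reach fa) lo0.
    + by move=> f; have [] := sv f.
    + by move=> f; rewrite cfg_rcons /Defs.step nx nx0 /= eqxx.
    + by move=> q /eqP ne; rewrite lo_setl_neq. }
  by apply: Psi_inv => //; apply: (f_reach fa).
- apply: (keep s) => //; first by move=> d; rewrite nx0.
  apply: same; rewrite ?nx0 //.
    by move=> f; rewrite valid_rcons (f_valid fa) nx nx0.
  by move=> f; rewrite cfg_rcons /Defs.step nx nx0 /= eqxx.
- have ih0 f : ih (loc (cfg (F f)) p) = None.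
    move: nx0; rewrite ihE /Defs.next; case: (ih _) => // h.
    by case: (iprog _ _ _) => // d g; case: (pf _).
  apply: (keep s) => //; first by move=> d; rewrite nx0.
  apply: same; rewrite ?nx0 //.
    by move=> f; rewrite valid_rcons (f_valid fa) nx nx0.
  by move=> f; rewrite cfg_rcons /Defs.step nx nx0 /= ih0.
Qed.

(** Before the first process is poised nobody can have invoked, so the automaton has not moved. *)
Lemma first_poised_sim : valid e0 -> first_poised I M e0 -> sim M e0 (st0 n).
Proof.
move=> v0 [_ fp].
suff: forall k, k <= size e0 -> sim M (take k e0) (st0 n).
  by move=> /(_ _ (leqnn _)); rewrite take_size.
elim=> [|k IH] hk.
  by rewrite take0; split.
have sm := IH (ltnW hk).
have x0 : 'I_n * nat by case: (e0) hk => [|x ?].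
have eE : take k.+1 e0 = rcons (take k e0) (nth x0 e0 k) by rewrite (take_nth x0).
have vk : valid (take k.+1 e0).
  by move: v0; rewrite -{1}(cat_take_drop k.+1 e0) /Defs.valid valid_from_cat => /andP[].
case: (nth x0 e0 k) eE => p c eE; rewrite eE in vk *.
apply: sim_same => //; first exact: reach0.
have := fp _ hk p; have := sim_loc sm p => /= -[h1 h2]; rewrite /Defs.next h2.
by case: (M _ _) => [d g||] //; [case: (pf _)|rewrite h1].
Qed.

Theorem expT_bound : valid e0 -> first_poised I M e0 ->
  (expT I M A e0 <= (Psi (st0 n))%:E)%E.
Proof.
move=> v0 fp; have sm := first_poised_sim v0 fp.
apply: ub_ereal_sup => _ [N _ <-].
have fa : family finset.set0 (fun _ => e0) (st0 n).
{ split=> //.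
  - exact: reach0.
  - by exists [::]; rewrite cats0.
  - by move=> f p; rewrite inE.
  - by move=> f p _; have := sim_loc sm p => /= -[_ ->].
  - by move=> f g; split=> // p; rewrite inE. }
have := family_bound N fa; rewrite -ge0_sume_distrl; last first.
  by move=> f _; rewrite lee_fin hprob_ge0.
by rewrite sumEFin hprob_sum // mul1e.
Qed.

End Deferral.

(** * Potential of the levels *)

(* [v i] bounds the expected number of processes entering level [i0] per process
   entering level [i].  A location [x < t i] whose successor is unmarked keeps a
   reserve of [2 v(i+1)]: a write marks [x] with probability at most twice that
   of marking [x+1], which releases the reserve, so these locations cost nothing
   on average.  The locations [x >= t i] are hit with probability [2^-(t i)]. *)
Section Levels.
Local Open Scope ring_scope.
Variables (n K i0 : nat) (t : nat -> nat) (v : nat -> Rl).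
Implicit Types (s : st n) (p q : 'I_n) (l : lst) (m : reg -> nat).

(** A process that has entered level [i0] keeps weight 1 even after losing, since [opened] goes on
    counting it. *)
Definition weight m l : Rl :=
  if (i0 < tp l)%N then 1 else
  match ph l with
  | PDoor => v 0
  | PGrpW => v (tp l).-1
  | PGrpR => (m (RGrp (tp l).-1 (gx l).+1) == 0)%:R * v (tp l)
  | PXW | PYR | PYW | PXR => v (tp l)
  | _ => 0
  end.

Definition weight_opt m (ol : option lst) : Rl := if ol is Some l then weight m l else 0.

Definition reserve m i : Rl := \sum_(x < t i) (m (RGrp i x.+1) == 0)%:R * (2 * v i.+1).

(** The first summand prepays the processes that may still invoke, which makes arrivals free. *)
Definition level_pot s : Rl :=
  (K - invoked s)%:R * v 0 + \sum_p weight_opt (me s) (lo s p)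
    + \sum_(i < i0) reserve (me s) i.

Lemma level_pot_invoke s p : lo s p = None -> (invoked (ainv p s) <= K)%N ->
  level_pot (ainv p s) <= level_pot s.
Proof.
move=> h; have iE : invoked (ainv p s) = (invoked s).+1.
  rewrite /invoked (cardD1 p) inE lo_setl_eq /= add1n; congr _.+1.
  apply: eq_card => q; rewrite !inE /=; case: eqP => [->|//]; by rewrite h.
rewrite iE => iK; rewrite /level_pot iE (bigD1 p) //= eqxx /= [in leRHS](bigD1 p) //= h /=.
rewrite lerD2r (eq_bigr (fun q => weight_opt (me s) (lo s q))); last first.
  by move=> q /negbTE ->.
rewrite {1}/weight /= add0r addrA lerD2r.
have -> : (K - invoked s)%N = (K - (invoked s).+1).+1 by lia.
by rewrite -[in leRHS]natr1 mulrDl mul1r.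
Qed.

Hypothesis v_ge0 : forall i, 0 <= v i.

Lemma weight_ge0 m l : 0 <= weight m l.
Proof.
rewrite /weight; case: ifP => // _; case: (ph l) => //; try exact: v_ge0.
by rewrite mulr_ge0 ?ler0n.
Qed.

Lemma reserve_ge0 m i : 0 <= reserve m i.
Proof. by apply: sumr_ge0 => x _; rewrite !mulr_ge0 ?ler0n. Qed.

Lemma opened_level_pot s : (#|opened s i0|)%:R <= level_pot s.
Proof.
rewrite /level_pot -[leLHS]addr0; apply: lerD; last first.
  by apply: sumr_ge0 => i _; apply: reserve_ge0.
rewrite -[leLHS]add0r; apply: lerD; first by rewrite mulr_ge0 ?ler0n.
rewrite -sum1_card natr_sum big_mkcond /=; apply: ler_sum => p _.
rewrite inE; case: (lo s p) => [l|] //=; rewrite /weight; case: ifP => // lt.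
by have := weight_ge0 (me s) l; rewrite /weight lt.
Qed.

Definition marks_le m m' := forall i x, m' (RGrp i x) = 0%N -> m (RGrp i x) = 0%N.

Lemma weight_anti m m' l : marks_le m m' -> weight m' l <= weight m l.
Proof.
move=> mm; rewrite /weight; case: ifP => // _; case: (ph l) => //.
apply: ler_wpM2r => //; case: eqP => [/mm ->|_]; rewrite ?eqxx ?lexx // ler0n //.
Qed.

Lemma reserve_anti m m' i : marks_le m m' -> reserve m' i <= reserve m i.
Proof.
move=> mm; apply: ler_sum => x _; apply: ler_wpM2r; first by rewrite mulr_ge0.
by case: eqP => [/mm ->|_]; rewrite ?eqxx ?lexx // ler0n.
Qed.

Lemma level_pot_setl s p l l' m' c : lo s p = Some l -> marks_le (me s) m' ->
  weight m' l' + \sum_(i < i0) reserve m' i <=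
    weight (me s) l + \sum_(i < i0) reserve (me s) i + c ->
  level_pot (setl s p l' m') <= level_pot s + c.
Proof.
move=> h mm hw; rewrite /level_pot.
have -> : invoked (setl s p l' m') = invoked s.
  by apply: eq_card => q; rewrite !inE /=; case: eqP => [->|//]; rewrite h.
rewrite (bigD1 p) //= eqxx /= [in leRHS](bigD1 p) //= h /=.
have : \sum_(q | q != p) weight_opt m' (if q == p then Some l' else lo s q) <=
    \sum_(q | q != p) weight_opt (me s) (lo s q).
  apply: ler_sum => q /negbTE ->; case: (lo s q) => //= lq; exact: weight_anti.
by move: hw; lra.
Qed.

(** The writer exchanges [v i] for [v i.+1], or for 0 if the successor of [x] is marked. If [x] was
    blank and lies in [1..t i], the reserve kept by location [x.-1] is released. *)
Lemma level_pot_group s p i e g r c k (x : nat) : (i < i0)%N ->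
  lo s p = Some (Lst PGrpW i.+1 e g r false c k) ->
  level_pot (setl s p (Lst PGrpR i.+1 e x r false c k.+1) (upd (me s) (RGrp i x) 1)) <=
  level_pot s + (v i.+1 * (me s (RGrp i x.+1) == 0)%:R - v i
    - (0 < x <= t i)%N%:R * (me s (RGrp i x) == 0)%:R * (2 * v i.+1)).
Proof.
move=> ii0 h; apply: (level_pot_setl h).
  by move=> i' x'; rewrite /upd regE /=; case: ifP.
rewrite /weight /= ltnS leqNgt ii0 /= /upd regE /= eqxx /= (gtn_eqF (ltnSn x)) [_ * v i.+1]mulrC.
rewrite (bigD1 (Ordinal ii0)) //= [in leRHS](bigD1 (Ordinal ii0)) //=.
rewrite [X in _ + (_ + X) <= _](_ : _ = \sum_(j < i0 | j != Ordinal ii0) reserve (me s) j); last first.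
  apply: eq_bigr => j ne; apply: eq_bigr => y _; rewrite regE /=.
  by have -> : (nat_of_ord j == i) = false by apply: contraNF ne => /eqP e0; apply/eqP/val_inj.
suff : reserve (upd (me s) (RGrp i x) 1) i <= reserve (me s) i
    - (0 < x <= t i)%N%:R * (me s (RGrp i x) == 0)%:R * (2 * v i.+1).
  by rewrite /upd; lra.
rewrite /reserve; case: (boolP (0 < x <= t i)%N) => hx; last first.
  rewrite !mul0r subr0; apply: ler_sum => y _; apply: ler_wpM2r; first by rewrite mulr_ge0.
  by rewrite /upd; case: ifP => // _; rewrite ler0n.
have xt : (x.-1 < t i)%N by lia.
rewrite (bigD1 (Ordinal xt)) //= [in leRHS](bigD1 (Ordinal xt)) //= prednK; last by lia.
rewrite {1}/upd eqxx /= mul0r add0r mul1r addrC addrK.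
by apply: ler_sum => y _; apply: ler_wpM2r; rewrite ?mulr_ge0 // /upd; case: ifP; rewrite ?ler0n.
Qed.

Variable B : nat.
Hypothesis i0_le : (i0 <= B)%N.
Hypothesis v_top : v i0 = 1.

Lemma step_marks p x m l l' m' : step_spec B p x m l l' m' -> marks_le m m'.
Proof. by case=> * i' x' //; rewrite /upd ?regE //=; case: ifP. Qed.

(** Crossing into level [i0] is free because [v i0 = 1]. By [i0 <= B] all lower levels begin with a
    group election, so the entrant has weight [v] of its level. *)
Lemma level_pot_step s p x l l' m' : lo s p = Some l ->
  step_spec B p x (me s) l l' m' ->
  (match ph l with PGrpW => (i0 < tp l)%N | _ => true end) ->
  level_pot (setl s p l' m') <= level_pot s.
Proof.
move=> h sp hl; rewrite -[leRHS]addr0; apply: level_pot_setl h (step_marks sp) _.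
rewrite addr0; apply: lerD; last by apply: ler_sum => i _; apply: reserve_anti (step_marks sp).
case: sp hl => //=; rewrite /weight /=.
- by move=> *; apply: v_ge0.
- move=> f _ g _ _ _ _ -> _; rewrite /enter; case: (ltnP i0 1) => h1.
    by have -> : 0%N = i0; [lia|rewrite v_top lexx].
  by rewrite ifT //; lia.
- by move=> i _ g _ _ _ _ ->.
- by move=> i _ g _ _ _ _ _ m0 _; case: ifP => // _; rewrite mulr_ge0 ?ler0n.
- by move=> i _ g _ _ _ _ _ -> _; rewrite eqxx mul1r.
- by move=> *; case: ifP.
- by move=> *; case: ifP.
- move=> f i _ g _ _ _ _ -> _; rewrite /enter; case: (ltnP i0 i.+1) => h1.
    by rewrite ifT //; lia.
  case: (ltnP i0 i.+2) => h2; last by rewrite ifT //; lia.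
  by have -> : i.+1 = i0; [lia|rewrite v_top lexx].
- by move=> t0 f i g r _ _ _ _ -> _; case: ifP => // _; case: ifP.
Qed.

Hypothesis B_gt1 : (1 < B)%N.
Hypothesis t_le : forall i, (i < i0)%N -> (t i <= B.-1)%N.
Hypothesis v_rec : forall i, (i < i0)%N -> v i = 2^-1 ^+ t i * v i.+1.

Lemma group_average i (z : nat -> bool) : (i < i0)%N ->
  \sum_(x < B) coinw B x * (v i.+1 * (z x.+1)%:R - v i
    - (0 < x <= t i)%N%:R * (z x)%:R * (2 * v i.+1)) <= 0.
Proof.
clear i0_le v_top; move=> ii0; have tB := t_le ii0.
have w0 x := coinw_ge0 B x.
suff hz : \sum_(0 <= x < B) coinw B x * (z x.+1)%:R <= 2^-1 ^+ t i +
    \sum_(0 <= x < B) coinw B x * ((0 < x <= t i)%N%:R * (z x)%:R * 2).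
  rewrite -(big_mkord xpredT (fun x => coinw B x * (v i.+1 * (z x.+1)%:R - v i
    - (0 < x <= t i)%N%:R * (z x)%:R * (2 * v i.+1)))).
  rewrite (eq_bigr (fun x => v i.+1 * (coinw B x * (z x.+1)%:R)
    - v i * coinw B x - v i.+1 * (coinw B x * ((0 < x <= t i)%N%:R * (z x)%:R * 2)))); last first.
    by move=> x _; ring.
  rewrite !sumrB -!mulr_sumr (coinw_tail B_gt1) // expr0 mulr1 (v_rec ii0).
  have := ler_wpM2l (v_ge0 i.+1) hz; rewrite mulrDr; lra.
(* From [t i] on the tail probability is the cost covered by [v i]; below it the sum is shifted by
   one location and compared through [coinw_double]. *)
rewrite (big_cat_nat (n := t i)) //=; last by lia.
rewrite addrC; apply: lerD.
  rewrite -(coinw_tail B_gt1 tB); apply: ler_sum => x _; apply: ler_piMr => //.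
  by case: (z _); rewrite ?ler0n.
rewrite [leRHS](big_cat_nat (n := (t i).+1)) //=; last by lia.
rewrite -[leLHS]addr0; apply: lerD; last first.
  by apply: sumr_ge0 => x _; rewrite !mulr_ge0.
rewrite big_nat_recl //= mul0r mul0r mulr0 add0r.
rewrite !big_mkord; apply: ler_sum => x _; rewrite ltn_ord mul1r.
rewrite (mulrC _ 2) mulrA; apply: ler_wpM2r => //.
by rewrite mulrC coinw_double //; have := ltn_ord x; lia.
Qed.

End Levels.

(** * The total potential *)

Section Potential.
Local Open Scope ring_scope.
Variables (n K i0 : nat) (t : nat -> nat) (v : nat -> Rl) (B : nat).
Implicit Types (s : st n) (p q : 'I_n) (l : lst).
Local Notation level_pot := (@level_pot n K i0 t v).

(** The factor 22 is 6 + 16: a level costs six steps and opens a race of initial potential 16. The 2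
    pays for the two accesses to the door. *)
Definition potential s : Rl :=
  2 + 22 * (i0%:R + level_pot s) + (race_total s)%:R - 16 * n%:R.

Lemma tp_opened s p l : reach B s -> lo s p = Some l -> (tp l <= i0 + #|opened s i0|)%N.
Proof.
move=> rs h; case: (ltnP i0 (tp l)) => [lt|]; first exact: opened_bound rs h lt.
by move=> le; lia.
Qed.

(** Levels from [i0 + #|opened s i0|] on have not been reached, so their races still hold 16. *)
Lemma race_total_ge s : reach B s ->
  (16 * n + \sum_p (if lo s p is Some l then lc l else 0) <=
   race_total s + 16 * (i0 + #|opened s i0|))%N.
Proof.
move=> rs; set a := (i0 + _)%N; rewrite /race_total.
suff : (16 * n <= \sum_(i < n) lam s i + 16 * a)%N by lia.
have -> : (16 * n = \sum_(i < n) 16)%N by rewrite sum_nat_const card_ord mulnC.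
apply: (@leq_trans (\sum_(i < n) (lam s i + (if i < a then 16 else 0)))%N).
  apply: leq_sum => i _; case: (ltnP i a) => ai; first by lia.
  rewrite (lam_16 rs) // => p l h; exact: leq_trans (tp_opened rs h) ai.
rewrite big_split leq_add2l /=; apply: (@leq_trans (16 * minn n a)); last by lia.
elim: (n) => [|j IHj]; first by rewrite big_ord0.
by rewrite big_ord_recr /=; case: ltnP; lia.
Qed.

Lemma potential_invoke s p : reach B s -> lo s p = None -> (invoked (ainv p s) <= K)%N ->
  potential (ainv p s) <= potential s.
Proof.
move=> rs h hK; have := level_pot_invoke i0 t v h hK; rewrite /potential race_total_invoke //.
by lra.
Qed.

Lemma potential0 : potential (st0 n) =
  2 + 22 * (i0%:R + (K%:R * v 0 + \sum_(i < i0) (t i)%:R * (2 * v i.+1))).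
Proof.
rewrite /potential; have -> : race_total (st0 n) = (16 * n)%N.
  rewrite /race_total big1 // add0n.
  rewrite (eq_bigr (fun _ => 16%N)); first by rewrite sum_nat_const card_ord mulnC.
  by move=> i _; apply: (lam_16 (reach0 n 0)) => p l.
have -> : level_pot (st0 n) = K%:R * v 0 + \sum_(i < i0) (t i)%:R * (2 * v i.+1).
  rewrite /level_pot /invoked (eq_card0 (A := [pred p | isSome (lo (st0 n) p)])) // subn0.
  rewrite big1 // addr0; congr (_ + _); apply: eq_bigr => i _.
  rewrite /reserve (eq_bigr (fun _ => 2 * v i.+1)) => [|x _]; last by rewrite mul1r.
  by rewrite sumr_const card_ord (mulr_natl (2 * v i.+1) (t i)).
rewrite natrM; lra.
Qed.

Hypothesis v_ge0 : forall i, 0 <= v i.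

Lemma potential_base s : reach B s ->
  2 + 6 * (i0 + #|opened s i0|)%:R + (\sum_p (if lo s p is Some l then lc l else 0))%:R
    <= potential s.
Proof.
move=> rs; have := race_total_ge rs; rewrite -(ler_nat Rl) natrD [in leRHS]natrD !natrM !(natrD _ i0) /potential.
have := @opened_level_pot n K i0 t v v_ge0 s; lra.
Qed.

Lemma potential_ge0 s : reach B s -> 0 <= potential s.
Proof. by move=> /potential_base; apply: le_trans; rewrite !addr_ge0 ?mulr_ge0 ?ler0n. Qed.

Lemma potential_ge s p l : reach B s -> lo s p = Some l -> (cn l)%:R <= potential s.
Proof.
move=> rs h; apply: le_trans (potential_base rs).
rewrite -natrM -!natrD ler_nat; have := cost_bound rs h; have := tp_opened rs h.
by rewrite (bigD1 p) //= h; lia.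
Qed.

Hypothesis B_gt1 : (1 < B)%N.
Hypothesis i0_le : (i0 <= B)%N.
Hypothesis t_le : forall i, (i < i0)%N -> (t i <= B.-1)%N.
Hypothesis v_top : v i0 = 1.
Hypothesis v_rec : forall i, (i < i0)%N -> v i = 2^-1 ^+ t i * v i.+1.

(** Averaging is needed only for group writes below level [i0] and for race writes; every other step
    lowers or keeps the potential for each coin. *)
Lemma potential_step s p l : reach B s -> lo s p = Some l -> active l ->
  \sum_(x < B) coinw B x * potential (astep B p x s) <= potential s.
Proof.
move=> rs h al; have wfl := reach_wf rs h.
have rx x : (x < B)%N -> reach B (astep B p x s) by exact: reachS rs h al.
have sp x := stepP p x (me s) wfl al.
have [[lW li]|[lW|nW]] : (is_true (if ph l is PGrpW then true else false) /\ (tp l <= i0)%N) \/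
    (is_true (if ph l is PRaceW then true else false) \/
     (is_true (if ph l is PRaceW then false else true) /\
      is_true (match ph l with PGrpW => (i0 < tp l)%N | _ => true end))).
- by case: (ph l); case: (ltnP i0 (tp l)) => ?; intuition.
- case: l h al wfl lW li sp => f tt e g r b c k h al; rewrite /wf /=; case: f h al => //.
  case: tt => // i h al /and3P[_ iB /negbTE bE] _ ii0 sp; subst b.
  pose z y := me s (RGrp i y) == 0%N.
  apply: (@le_trans _ _ (\sum_(x < B) coinw B x * (potential s + 22 * (v i.+1 * (z x.+1)%:R - v i
    - (0 < x <= t i)%N%:R * (z x)%:R * (2 * v i.+1))))).
    apply: ler_sum => x _; apply: ler_wpM2l; first exact: coinw_ge0.
    have := rx x (ltn_ord x); have := sp x; rewrite (astepE _ _ h) /= => spx rsx.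
    have := race_total_step rs rsx h spx isT; rewrite -(ler_nat Rl) => hr.
    have := level_pot_group K t v_ge0 x ii0 h.
    rewrite /potential; move: hr; rewrite /upd /z; lra.
  rewrite (eq_bigr (fun x : 'I_B => coinw B x * potential s + 22 * (coinw B x *
    (v i.+1 * (z x.+1)%:R - v i - (0 < x <= t i)%N%:R * (z x)%:R * (2 * v i.+1))))); last first.
    by move=> x _; ring.
  rewrite big_split -mulr_suml -mulr_sumr /= coinw_sum // mul1r.
  by have := group_average v_ge0 B_gt1 t_le v_rec z ii0; lra.
- case: l h al wfl lW sp => f tt e g r b c k h al wfl lW sp; case: f h al wfl lW sp => // h al wfl _ sp.
  have lp x : (x < B)%N -> level_pot (astep B p x s) <= level_pot s.
    by move=> xB; have := sp x; rewrite (astepE _ _ h) => spx; apply: (level_pot_step _ _ v_ge0 i0_le v_top h spx).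
  have [i [it eE bE]] : exists i, [/\ (i < tt)%N, e = i.+1 & b = true].
    by move: wfl; rewrite /wf /=; case: e {h al sp lp} => [|i] /and3P[-> ? ?] //; exists i.
  subst e b.
  set m1 := upd (me s) (RRace i (i.+1 != tt)) r.+1; set m2 := upd (me s) RDummy r.+1.
  pose T1 := race_total (setl s p (Lst PRaceR tt i.+1 g r.+1 true c.+1 k.+1) m1).
  pose T2 := race_total (setl s p (Lst PRaceR tt i.+1 g r true c.+1 k.+1) m2).
  have a0 : astep B p 0 s = setl s p (Lst PRaceR tt i.+1 g r.+1 true c.+1 k.+1) m1.
    by rewrite (astepE _ _ h).
  have a1 x : (0 < x)%N -> astep B p x s = setl s p (Lst PRaceR tt i.+1 g r true c.+1 k.+1) m2.
    by move=> x0; rewrite (astepE _ _ h) /= (gtn_eqF x0).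
  have r1 : reach B (setl s p (Lst PRaceR tt i.+1 g r.+1 true c.+1 k.+1) m1).
    by rewrite -a0; apply: rx; lia.
  have r2 : reach B (setl s p (Lst PRaceR tt i.+1 g r true c.+1 k.+1) m2).
    by rewrite -(a1 1%N) //; apply: rx.
  have := race_total_write rs r1 r2 h it erefl erefl; rewrite -(ler_nat Rl) natrD natrM => hT.
  apply: (@le_trans _ _ (\sum_(x < B) coinw B x * (potential s - (race_total s)%:R +
      (race_total (astep B p x s))%:R))).
    apply: ler_sum => x _; apply: ler_wpM2l; first exact: coinw_ge0.
    by have := lp x (ltn_ord x); rewrite /potential; lra.
  rewrite (@coin_avg2 _ B_gt1 (fun x => potential s - (race_total s)%:R + (race_total (astep B p x s))%:R)
    (potential s - (race_total s)%:R + T1%:R) (potential s - (race_total s)%:R + T2%:R)).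
  + by move: hT; rewrite /T1 /T2; lra.
  + by rewrite a0.
  + by move=> x /andP[x0 _]; rewrite a1.
- apply: (@coin_avg_le _ B_gt1 (fun x => potential (astep B p x s))) => x xB.
  have := rx x xB; have := sp x; rewrite (astepE _ _ h) => spx rsx.
  have := race_total_step rs rsx h spx nW.1; rewrite -(ler_nat Rl).
  have := level_pot_step K t v_ge0 i0_le v_top h spx nW.2; rewrite /potential; lra.
Qed.

End Potential.

(** * Linearizability *)

Section Histories.
Variable n : nat.
Implicit Types (h : seq (event n)) (p q w : 'I_n).

Definition responders h : seq 'I_n :=
  pmap (fun ev => if ev is Resp p _ then Some p else None) h.

Lemma responders_cat h h' : responders (h ++ h') = responders h ++ responders h'.
Proof. exact: pmap_cat. Qed.

Lemma respondersP h p : reflect (exists b, List.In (Resp p b) h) (p \in responders h).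
Proof.
apply: (iffP idP); last first.
  by case=> b; elim: h => //= ev h IH [->|/IH]; rewrite /= ?inE ?eqxx //; case: ev => //= *;
    rewrite inE; apply/orP; right.
elim: h => //= -[q|q b] h IH /=; first by move=> /IH[b hb]; exists b; right.
by rewrite inE => /orP[/eqP->|/IH[b' hb]]; [exists b; left|exists b'; right].
Qed.

Lemma nth_error_rcons h ev i x : List.nth_error (rcons h ev) i = Some x ->
  (i < size h /\ List.nth_error h i = Some x) \/ (i = size h /\ x = ev).
Proof.
elim: h i => [|y h IH] [|i] //=; first by case=> ->; right.
- by case: i.
- by move=> e; left.
- by move=> /IH[[? ?]|[-> ->]]; [left|right].
Qed.

Lemma In_rcons h ev x : List.In x (rcons h ev) <-> List.In x h \/ x = ev.
Proof.
elim: h => [|y h IH] /=; first by split=> [[]|[]] // ->; [right|left].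
by rewrite IH; tauto.
Qed.

Lemma In_take h i j x : List.nth_error h i = Some x -> i < j -> List.In x (take j h).
Proof.
elim: h i j => [|y h IH] [|i] [|j] //=; first by case=> ->; left.
by move=> hi ij; right; apply: (IH i).
Qed.

Lemma In_take_nth h j x : List.In x (take j h) ->
  exists2 i, i < j & List.nth_error h i = Some x.
Proof.
elim: h j => [|y h IH] [|j] //= [->|/IH[i ij hi]]; first by exists 0.
by exists i.+1.
Qed.

(** The order is [w], then the other responders in order of response; other pending operations are
    left out. *)
Lemma linearizable_winner h w : uniq (responders h) ->
  (forall p b, List.In (Resp p b) h -> List.In (Defs.Inv p) h) ->
  (forall p b i j, List.nth_error h i = Some (Resp p b) ->
     List.nth_error h j = Some (Defs.Inv p) -> ~~ (i < j)) ->
  List.In (Defs.Inv w) h ->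
  (forall p b i j, List.nth_error h i = Some (Resp p b) ->
     List.nth_error h j = Some (Defs.Inv w) -> ~~ (i < j)) ->
  (forall p b, List.In (Resp p b) h -> b = (p != w)) ->
  linearizable h.
Proof.
move=> uh rinv rord iw word wb; exists (w :: [seq q <- responders h | q != w]); split.
- by rewrite /= filter_uniq // mem_filter eqxx.
- move=> p; rewrite inE mem_filter => /orP[/eqP->//|/andP[_ /respondersP[b]]]; exact: rinv.
- move=> p b hp; rewrite inE mem_filter; case: eqP => //= _.
  by apply/respondersP; exists b.
- move=> p q b i j hp hq ij qL; have nqw : q != w.
    by apply: contraTneq ij => e; move: hq; rewrite e; apply: word hp.
  rewrite /= (eq_sym w q) (negbTE nqw) (eq_sym w p); have [//|npw] := eqVneq p w.
  (* Cut the history at the invocation of [q]: by then [p] has responded and [q] has not. *)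
  rewrite ltnS -(cat_take_drop j h) responders_cat filter_cat !index_cat.
  have -> : p \in [seq x <- responders (take j h) | x != w].
    rewrite mem_filter npw; apply/respondersP; exists b; exact: In_take hp ij.
  have -> : q \in [seq x <- responders (take j h) | x != w] = false.
    apply/negbTE; rewrite mem_filter negb_and; apply/orP; right; apply/respondersP => -[b' hb'].
    by have [i' i'j hi'] := In_take_nth hb'; move: (rord _ _ _ _ hi' hq); rewrite i'j.
  apply: leq_trans (leq_addr _ _); rewrite index_mem mem_filter npw.
  by apply/respondersP; exists b; apply: In_take hp ij.
- by move=> p b /wb ->; rewrite /= eq_sym; case: eqP.
Qed.

Variable M : malg n.
Local Notation I := (tas n).
Local Notation B := (width n).
Implicit Types (e : exec n) (s : st n).

(** [hi_late] expresses the door: a loss is returned only once the door is shut, so later callers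
    never enter. *)
Record hist_inv e s : Prop := HistInv {
  hi_inv : forall p, List.In (Defs.Inv p) (hist I M e) <-> lo s p <> None;
  hi_resp : forall p b, List.In (Resp p b) (hist I M e) ->
    ih (loc (cfg I M e) p) = None /\ exists2 l, lo s p = Some l & ph l = PRet b;
  hi_uniq : uniq (responders (hist I M e));
  hi_order : forall p b i j, List.nth_error (hist I M e) i = Some (Resp p b) ->
    List.nth_error (hist I M e) j = Some (Defs.Inv p) -> ~~ (i < j);
  hi_late : forall p q i j, List.nth_error (hist I M e) i = Some (Resp p true) ->
    List.nth_error (hist I M e) j = Some (Defs.Inv q) -> i < j ->
    exists2 l, lo s q = Some l & tp l = 0 }.

(** The winner [w] is the process that returned [false] or, as long as there is none, any process
    that has not lost. Having passed the door, it was not invoked after a returned loss. *)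
Lemma linearizable_hist e s : reach B s -> hist_inv e s -> linearizable (hist I M e).
Proof.
move=> rs hi; set h := hist I M e.
have [r0|rne] := eqVneq (responders h) [::].
  have no p b : List.In (Resp p b) h -> False.
    move=> hp; suff : p \in responders h by rewrite r0.
    by apply/respondersP; exists b.
  exists [::]; split=> //; by move=> p b /no.
have [p0 [b0 hp0]] : exists p b, List.In (Resp p b) h.
  case E: (responders h) rne => [//|p r] _.
  have : p \in responders h by rewrite E inE eqxx.
  by case/respondersP => b hb; exists p, b.
have [w [lw [hw [nlw win]]]] : exists w lw, lo s w = Some lw /\ nonlost lw /\
    forall q lq, lo s q = Some lq -> ph lq = PRet false -> q = w.
  case: (pselect (exists q lq, lo s q = Some lq /\ ph lq = PRet false)) => [[q [lq [hq rq]]]|no].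
    exists q, lq; split=> //; split; last by move=> q' lq' hq' rq'; apply: winner_uniq rs hq' hq rq' rq.
    by have := reach_wf rs hq; rewrite /wf /nonlost rq => /and3P[_ -> _].
  have [_ [l0 hl0 rl0]] := hi_resp hi hp0.
  have b0t : b0 = true by case: b0 rl0 {hp0} => // rl0; case: no; exists p0, l0.
  have [w [lw [hw nlw]]] := exists_nonlost rs hl0 (or_intror (loser_shut rs hl0 (etrans rl0 (congr1 _ b0t)))).
  by exists w, lw; split=> //; split=> // q lq hq rq; case: no; exists q, lq.
have tpw : 0 < tp lw by case/andP: nlw.
apply: (@linearizable_winner h w).
- exact: (hi_uniq hi).
- by move=> p b hp; have [_ [l hl _]] := hi_resp hi hp; apply/(hi_inv hi); rewrite hl.
- exact: (hi_order hi).
- by apply/(hi_inv hi); rewrite hw.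
- move=> p b i j hp hj; apply/negP => ij.
  case: b hp => hp.
    by have [l] := hi_late hi hp hj ij; rewrite hw => -[<-] e0; rewrite e0 in tpw.
  have [_ [l hl rl]] := hi_resp hi (List.nth_error_In _ _ hp).
  by move: (win _ _ hl rl) hp => -> hp; move: (hi_order hi hp hj); rewrite ij.
- move=> p b hp; have [_ [l hl rl]] := hi_resp hi hp.
  case: b rl {hp} => rl; last by rewrite (win _ _ hl rl) eqxx.
  by apply/esym/eqP => e0; move: hl nlw rl; rewrite e0 hw => -[->]; rewrite /nonlost => + rl; rewrite rl andbF.
Qed.

Lemma hist_inv_step e s p k : reach B s -> sim M e s -> hist_inv e s ->
  valid I M (rcons e (p, k)) ->
  exists s', [/\ reach B s', sim M (rcons e (p, k)) s' & hist_inv (rcons e (p, k)) s'].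
Proof.
move=> rs sm hi vr; have [s' [sm' st]] := simP rs sm vr.
exists s'.
have ihk q : lo s q <> None -> ih (loc (cfg I M e) q) = None ->
    ih (loc (cfg I M (rcons e (p, k))) q) = None.
  move=> ls h0; rewrite cfg_rcons; have [e0|ne] := eqVneq q p; last by rewrite step_other.
  subst q; rewrite /Defs.step; have := sim_loc sm p; rewrite /sim_lst /Defs.next h0.
  case: (lo s p) ls => // l _ [iv _].
  case: (M p _) => [d f||]; rewrite ?iv //=; case: (pf _) => [y|] /=; rewrite ?eqxx //.
  by case: (f y) => [r|r v] /=; rewrite eqxx.
have keep : (step I M (cfg I M e) p k).2 = None ->
    (forall q, lo s' q <> None <-> lo s q <> None) ->
    (forall q l b, lo s q = Some l -> ph l = PRet b -> lo s' q = Some l) ->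
    (forall q l, 0 < me s RDoor -> lo s q = Some l -> tp l = 0 ->
       exists2 l', lo s' q = Some l' & tp l' = 0) ->
    hist_inv (rcons e (p, k)) s'.
{ move=> ev hA hB hC; have hE : hist I M (rcons e (p, k)) = hist I M e.
    by rewrite hist_rcons ev cats0.
  split; rewrite hE; try by case: hi.
  - by move=> q; rewrite (hi_inv hi) hA.
  - move=> q b hq; have [h0 [l hl rl]] := hi_resp hi hq; split.
      by apply: ihk => //; rewrite hl.
    by exists l => //; apply: hB hl rl.
  - move=> q1 q2 i j h1 h2 ij; have [l hl tl] := hi_late hi h1 h2 ij.
    have [_ [l1 hl1 rl1]] := hi_resp hi (List.nth_error_In _ _ h1).
    exact: hC (loser_shut rs hl1 rl1) hl tl. }
have nxR b : Defs.next I M (cfg I M e) p = NReturn _ b -> ih (loc (cfg I M e) p) <> None.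
  rewrite /Defs.next; case: (ih _) => //; case: (M _ _) => [d f||] //; first by case: (pf _).
  by case: (invd _).
have ihR b : Defs.next I M (cfg I M e) p = NReturn _ b ->
    ih (loc (cfg I M (rcons e (p, k))) p) = None.
  by move=> nx; rewrite cfg_rcons /Defs.step nx /= eqxx.
move: (hist_rcons I M e p k) nxR ihR; case: st sm' keep => [d|o||lo0|b l hl rl|l x hl al xB hpf] sm' keep hE nxR ihR.
- by split=> //; apply: keep => // q l _ hl tl; exists l.
- by split=> //; apply: keep => // q l _ hl tl; exists l.
- by split=> //; apply: keep => // q l _ hl tl; exists l.
- have lok q l : lo s q = Some l -> lo (ainv p s) q = Some l.
    by move=> hq; rewrite lo_setl_neq // => e0; rewrite e0 lo0 in hq.
  split=> //; first exact: reachI.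
  rewrite /= cats1 in hE; split; rewrite hE.
  + move=> q; rewrite In_rcons (hi_inv hi) lo_setl; case: eqP => [->|ne].
      by split=> // _; right.
    by split=> [[|[]]//|]; left.
  + move=> q b /In_rcons[|//] hq; have [h0 [l hl rl]] := hi_resp hi hq; split.
      by apply: ihk => //; rewrite hl.
    by exists l => //; apply: lok.
  + by rewrite -cats1 responders_cat cats0; apply: (hi_uniq hi).
  + move=> q b i j /nth_error_rcons[[si hi']|[_ //]] /nth_error_rcons[[sj hj]|[jE [qE]]].
      exact: (hi_order hi hi' hj).
    by subst q; have [_ [l]] := hi_resp hi (List.nth_error_In _ _ hi'); rewrite lo0.
  + move=> q1 q2 i j /nth_error_rcons[[si hi']|[_ //]] /nth_error_rcons[[sj hj]|[jE [qE]]] ij.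
      by have [l hl tl] := hi_late hi hi' hj ij; exists l => //; apply: lok.
    by subst q2; exists lst0 => //; rewrite lo_setl_eq.
- split=> //; rewrite /= cats1 in hE; split; rewrite hE.
  + by move=> q; rewrite In_rcons (hi_inv hi); split=> [[|]//|]; left.
  + move=> q b' /In_rcons[hq|[-> ->]].
      have [h0 [l' hl' rl']] := hi_resp hi hq; split; last by exists l'.
      by apply: ihk => //; rewrite hl'.
    by split; [exact: ihR|exists l].
  + rewrite -cats1 responders_cat cat_uniq (hi_uniq hi) /= orbF andbT.
    apply/respondersP => -[b' hb']; have [h0 _] := hi_resp hi hb'.
    exact: (nxR _ erefl h0).
  + move=> q b' i j /nth_error_rcons[[si hi']|[-> _]] /nth_error_rcons[[sj hj]|[_ //]].
      exact: (hi_order hi hi' hj).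
    by rewrite -leqNgt ltnW.
  + move=> q1 q2 i j /nth_error_rcons[[si hi']|[-> _]] /nth_error_rcons[[sj hj]|[_ //]] ij.
      exact: (hi_late hi hi' hj ij).
    by lia.
- split=> //; first exact: reachS hl al xB.
  have ls q l' : lo (astep B p x s) q = Some l' -> q <> p -> lo s q = Some l'.
    by rewrite (astepE _ _ hl) => + ne; rewrite lo_setl_neq.
  apply: keep => // [q|q l' b' hq rl'|q l' dr hq tl'].
  + by rewrite (astepE _ _ hl) lo_setl; case: eqP => [->|//]; rewrite hl.
  + rewrite (astepE _ _ hl) lo_setl_neq // => e0.
    by move: hq al; rewrite e0 hl => -[->]; rewrite /active rl'.
  + have [e0|/eqP ne] := eqVneq q p; last by exists l'; rewrite // (astepE _ _ hl) lo_setl_neq.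
    move: hq; rewrite e0 hl => -[lE]; rewrite (astepE _ _ hl); eexists; first exact: lo_setl_eq.
    have := stepP p x (me s) (reach_wf rs hl) al; rewrite lE in tl' *; move=> spl.
    by move: dr tl'; case: spl => // *; lia.
Qed.

Theorem tas_linearizable e : valid I M e -> linearizable (hist I M e).
Proof.
move=> ve; suff [s [rs _ hi]] : exists s, [/\ reach B s, sim M e s & hist_inv e s].
  exact: linearizable_hist rs hi.
elim/last_ind: e ve => [|e [p k] IH] ve.
  exists (st0 n); split; [exact: reach0|by split|].
  by split=> // p q [|i] // [|j].
have [s [rs sm hi]] : exists s, [/\ reach B s, sim M e s & hist_inv e s].
  by apply: IH; move: ve; rewrite valid_rcons => /andP[].
exact: hist_inv_step rs sm hi ve.
Qed.

End Histories.

(** * The iterated logarithm *)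

Section Tower.
Local Open Scope nat_scope.

Fixpoint tower (j : nat) : nat := if j is j'.+1 then 2 ^ tower j' else 1.

(* [capped b j] is [- log2] of the weight [v] at [j] levels before the last
   one; the cap [b] is the number of locations available, and without it the
   sequence grows like a tower. *)
Fixpoint capped (b j : nat) : nat :=
  if j is j'.+1 then capped b j' + minn (2 ^ capped b j') b else 0.

Lemma tower_gt j : j < tower j.
Proof. by elim: j => //= j IH; apply: leq_ltn_trans IH (ltn_expl _ _). Qed.

Lemma capped_ge b j : 0 < b -> j <= capped b j.
Proof.
move=> b0; elim: j => //= j IH.
have : 0 < minn (2 ^ capped b j) b by rewrite leq_min b0 expn_gt0.
lia.
Qed.

(** A step of [capped] exponentiates unless the cap is effective, and then it adds [b] at once. *)
Lemma capped_tower b j : 0 < b -> (tower j <= capped b j.+1) || (b <= capped b j.+1).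
Proof.
move=> b0; elim: j => [|j IH]; first by rewrite /= add0n leq_min b0.
rewrite [capped b j.+2]/= -/(capped b j.+1); set c := capped b j.+1 in IH *.
case/orP: IH => h; last by apply/orP; right; lia.
have : tower j.+1 <= 2 ^ c by rewrite /= leq_exp2l.
by case: (leqP (2 ^ c) b) => h1 h2; apply/orP; [left|right]; lia.
Qed.

Local Open Scope ring_scope.

Lemma log2_le (x : Rl) (m : nat) : log2 x <= m%:R -> x <= (2 ^ m)%:R.
Proof.
case: (lerP x 0) => [x0 _|x0]; first by apply: le_trans x0 (ler0n _ _).
have l2 : 0 < ln 2 :> Rl by rewrite ln_gt0 // ltr1n.
rewrite /log2 ler_pdivrMr // natrX => h.
by rewrite -ler_ln ?posrE ?exprn_gt0 ?ltr0n // lnXn ?ltr0n // -[leRHS]mulr_natl.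
Qed.

Lemma iterlog_le i j (x : Rl) : iterlog (i + j) x <= 1 -> iterlog i x <= (tower j)%:R.
Proof.
elim: j i => [|j IH] i; first by rewrite addn0.
by rewrite addnS -addSn => /IH /log2_le.
Qed.

Lemma logstar_tower k : (k <= tower (logstar k))%N.
Proof.
rewrite /logstar; set P := (fun i => _); case: (boolP (has P (iota 0 k.+1))) => hP.
  have := nth_find 0%N hP; rewrite nth_iota ?add0n; last first.
    by rewrite has_find size_iota in hP.
  by move=> h; have := @iterlog_le 0%N _ _ h; rewrite /= ler_nat.
(* A failed search returns the length [k.+1], and [tower k.+1] exceeds [k] anyway. *)
rewrite hasNfind // size_iota; have := tower_gt k.+1; lia.
Qed.

Lemma logstar_gt0 k : (1 < k)%N -> (0 < logstar k)%N.
Proof.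
move=> k1; rewrite /logstar /=; case: ifP => //=; rewrite -[1]/(1%:R) ler_nat; lia.
Qed.

End Tower.

(** * Number of registers and choice of the parameters *)

Lemma nregs_bounds n : (0 < n)%N -> (nregs n <= 16 * n)%N /\ (n <= 16 * nregs n)%N.
Proof.
move=> n0; rewrite nregsE /width; split; last by lia.
have := trunc_logP (isT : 1 < 2)%N n0; set a := trunc_log 2 n => ha.
(* With [2 ^ a <= n] the total is at most [2 + 6 * n + 4 * n.+1], hence at most [16 * n]. *)
suff : (a.+2 * a.+3 <= 6 * 2 ^ a)%N by lia.
elim: (a) => // c IH; rewrite expnS; nia.
Qed.

Local Open Scope ring_scope.

Lemma tas_expected n k (M : malg n) (A : adversary n) (e : exec n) : (0 < n)%N -> (1 < k)%N ->
  oblivious (tas n) M A -> valid (tas n) M e ->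
  first_poised (tas n) M e -> contention_le (tas n) M e k ->
  (expT (tas n) M A e <= (156 * (logstar k)%:R)%:E)%E.
Proof.
move=> n0 k1 Aobl ve fp ck; pose b := (width n).-1; pose K := minn k n.
have cK : contention_le (tas n) M e K.
  move=> s vs; rewrite leq_min ck //= -[X in (_ <= X)%N]card_ord; exact: max_card.
have nb : (n < 2 ^ b)%N by rewrite /b /width /=; apply: trunc_log_ltn.
have b0 : (0 < b)%N by [].
have Kb : (K <= 2 ^ b)%N by rewrite /K; lia.
(* The least such [i0] is the number of levels after which the share [K * v 0] of the callers has
   dropped to 1. *)
have exj : exists j, (K <= 2 ^ capped b j)%N.
  exists b; apply: leq_trans Kb _; rewrite leq_exp2l //; exact: capped_ge.
have [i0 Ki0 i0_min] := ex_minnP exj.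
have i0b : (i0 <= b)%N.
  by apply: i0_min; apply: leq_trans Kb _; rewrite leq_exp2l //; apply: capped_ge.
have i0L : (i0 <= (logstar k).+1)%N.
  apply: i0_min; case/orP: (capped_tower (logstar k) b0) => h.
    apply: leq_trans (_ : _ <= k)%N _; first exact: geq_minl.
    apply: leq_trans (logstar_tower k) _; apply: leq_trans h _; exact: ltnW (ltn_expl _ _).
  by apply: leq_trans Kb _; rewrite leq_exp2l.
(* With [v i.+1 = 2^-c] the value [t i <= 2^c] is the largest that keeps the initial reserve
   [2 * t i * v i.+1] of a level at most 2, subject to the cap [b]. *)
pose t i := minn (2 ^ capped b (i0 - i.+1)) b.
pose v i : Rl := 2^-1 ^+ capped b (i0 - i).
have B1 := width_gt1 n.
have i0B : (i0 <= width n)%N by rewrite /b in i0b; lia.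
have tB i : (i < i0)%N -> (t i <= (width n).-1)%N by move=> _; apply: geq_minr.
have v0 i : 0 <= v i by rewrite exprn_ge0 // invr_ge0.
have vtop : v i0 = 1 by rewrite /v subnn expr0.
have vrec i : (i < i0)%N -> v i = 2^-1 ^+ t i * v i.+1.
  by move=> ii; rewrite /v /t -exprD -(subnSK ii) /= addnC.
have := @expT_bound n M A e K Aobl cK (@potential n K i0 t v)
  (@potential_ge n K i0 t v (width n) v0)
  (@potential_ge0 n K i0 t v (width n) v0)
  (@potential_invoke n K i0 t v (width n))
  (@potential_step n K i0 t v (width n) v0 B1 i0B tB vtop vrec) ve fp.
move=> /le_trans; apply; rewrite lee_fin potential0 //.
have Kv : K%:R * v 0%N <= 1.
  rewrite /v subn0 exprVn ler_pdivrMr ?exprn_gt0 // mul1r -natrX ler_nat.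
  exact: Ki0.
have tv : \sum_(i < i0) (t i)%:R * (2 * v i.+1) <= 2 * i0%:R.
  apply: (@le_trans _ _ (\sum_(i < i0) 2)); last by rewrite sumr_const card_ord mulr_natr.
  apply: ler_sum => i _; rewrite mulrCA -[leRHS]mulr1 ler_pM2l //.
  rewrite /v exprVn ler_pdivrMr ?exprn_gt0 // mul1r -natrX ler_nat; exact: geq_minl.
(* The value is at most [2 + 22 * (i0 + 1 + 2 * i0) = 24 + 66 * i0]. With [i0 <= logstar k + 1] and
   [1 <= logstar k] this gives 24 + 66 + 66 = 156. *)
have L1 := logstar_gt0 k1.
move: i0L L1; rewrite -!(ler_nat Rl) -[(logstar k).+1%:R]natr1; lra.
Qed.

Theorem theorem3 :
  exists (m : nat -> nat) (c : nat),
    (forall n, (0 < n)%N -> (m n <= c * n)%N /\ (n <= c * m n)%N) /\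
    exists I : forall n, impl n (m n),
      (forall n (M : malg n) (e : exec n),
          valid (I n) M e -> linearizable (hist (I n) M e)) /\
      exists (C : Rl) (k0 : nat),
        forall n k, (0 < n)%N -> (k0 <= k)%N ->
        forall (M : malg n) (A : adversary n) (e' : exec n),
          oblivious (I n) M A ->
          valid (I n) M e' -> follows A e' ->
          first_poised (I n) M e' -> contention_le (I n) M e' k ->
          (expT (I n) M A e' <= (C * (logstar k)%:R)%:E)%E.
Proof.
exists nregs, 16%N; split; first exact: nregs_bounds.
exists tas; split; first by move=> n M e; apply: tas_linearizable.
(* For [k <= 1] the iterated logarithm is 0 and so would be the bound, hence the threshold 2. *)
exists 156, 2%N => n k n0 k2 M A e' Aobl ve _ fp ck.
exact: tas_expected.
Qed.
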